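(* Let $R$ be a commutative ground ring and $n\ge 1$. The configuration pairing $\langle\cdot,\cdot\rangle:\Gamma_n\otimes\Theta_n\to R$ vanishes on $I_n\otimes\Theta_n$ and on $\Gamma_n\otimes J_n$, and the induced pairing $\langle\cdot,\cdot\rangle$ between $\mathrm{Lie}(n)=\Theta_n/J_n$ and $\mathrm{Eil}(n)=\Gamma_n/I_n$ is perfect.
   Context: Fix a commutative ground ring $R$ and write $\mathbf n=\{1,\dots,n\}$. Trees. A Tree is an isotopy class of finite connected acyclic graphs whose vertices are trivalent or univalent, with a distinguished univalent vertex called the root, embedded in the upper half-plane with the root at the origin. The univalent non-root vertices are called leaves and are labeled bijectively by $\mathbf n$; trivalent vertices are called internal vertices. By the planar embedding each internal vertex has a left and a right branch (the two edges leading away from the root). The height of a vertex is the number of edges between it and the root; the nadir of a path is the vertex of lowest height it traverses. Trees correspond to bracket expressions in $x_1,\dots,x_n$ using each variable once: an internal vertex with left subtree $A$ and right subtree $B$ corresponds to $[A,B]$. Graphs. A Graph is a finite connected graph with oriented edges, each joining two distinct vertices (several edges may join the same two vertices), with vertices labeled bijectively by $\mathbf n$. Let $\Theta_n$ (resp. $\Gamma_n$) be the free $R$-module generated by Trees (resp. Graphs) labeled by $\mathbf n$. Configuration pairing. For a Graph $G$ and a Tree $T$, let $\beta_{G,T}:\{\text{edges of }G\}\to\{\text{internal vertices of }T\}$ send an edge $e$ from $i$ to $j$ to the nadir of the shortest path $p_T(e)$ in $T$ from leaf $i$ to leaf $j$. Set $\langle G,T\rangle=(-1)^N$ if $\beta_{G,T}$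 is a bijection, where $N$ is the number of edges $e$ of $G$ for which $p_T(e)$ travels from left to right at its nadir, and $\langle G,T\rangle=0$ otherwise. Extend bilinearly to $\Gamma_n\otimes\Theta_n$. Relations. $J_n\subset\Theta_n$ is the submodule generated by: (i) Jacobi combinations, i.e. sums of three Trees that agree outside one subtree, where in that place they have respectively the subtrees $[[A,B],C]$, $[[C,A],B]$, $[[B,C],A]$ for some fixed trees $A,B,C$; (ii) symmetry combinations, i.e. sums of two Trees that are isomorphic as graphs and have the same left/right ordering of branches at every internal vertex except exactly one. $I_n\subset\Gamma_n$ is the submodule generated by: (i) Arnold combinations, i.e. sums of three Graphs that differ only in two edges among three distinct vertices $i,j,k$, these edges being respectively $\{i\to j,\ j\to k\}$, $\{j\to k,\ k\to i\}$, $\{k\to i,\ i\to j\}$; (ii) symmetry combinations, i.e. sums of two Graphs which differ in the orientation of exactly one edge; (iii) Graphs having two edges with the same pair of endpoints. A pairing between modules is perfect if both adjoint maps (each module to the $R$-linear dual of the other) are isomorphisms. *)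

(* Defs.v *)
From HB Require Import structures.
From mathcomp Require Import all_boot all_order all_algebra.
From mathcomp Require Import finmap monalg boolp.

Set Implicit Arguments.
Unset Strict Implicit.
Unset Printing Implicit Defensive.

Import GRing.Theory.
Local Open Scope ring_scope.
Local Open Scope quotient_scope.

(** [{malg R[K]}] carries a module structure in the library only for
    non-trivial [R]; [freemod] is the same group of finitely supported
    functions, as a module over an arbitrary ring, possibly zero. *)

Definition freemod (R : pzRingType) (K : choiceType) : Type := {malg R[K]}.

Section FreeModule.
Variables (R : pzRingType) (K : choiceType).
Implicit Types (a b : R) (g h : freemod R K).

HB.instance Definition _ := GRing.Zmodule.on (freemod R K).

Definition gen (k : K) : freemod R K := << (1 : R) *g k >>.

Definition freemod_scale a g : freemod R K :=
  [malg k in msupp g => a * (g : {malg R[K]})@_k].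

Lemma freemod_scaleE a g k : (freemod_scale a g)@_k = a * g@_k.
Proof.
by rewrite /freemod_scale mcoeffE; case: (msuppP g k) => // _; rewrite mulr0.
Qed.

Lemma freemod_scaleA a b g :
  freemod_scale a (freemod_scale b g) = freemod_scale (a * b) g.
Proof. by apply/malgP => k; rewrite !freemod_scaleE mulrA. Qed.

Lemma freemod_scale1 : left_id 1 freemod_scale.
Proof. by move=> g; apply/malgP => k; rewrite freemod_scaleE mul1r. Qed.

Lemma freemod_scaleDr : right_distributive freemod_scale +%R.
Proof.
move=> a g h; apply/malgP => k.
by rewrite freemod_scaleE !mcoeffD !freemod_scaleE mulrDr.
Qed.

Lemma freemod_scaleDl g : {morph freemod_scale^~ g : a b / a + b}.
Proof.
by move=> a b; apply/malgP => k; rewrite mcoeffD !freemod_scaleE mulrDl.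
Qed.

HB.instance Definition _ := GRing.Zmodule_isLmodule.Build R (freemod R K)
  freemod_scaleA freemod_scale1 freemod_scaleDr freemod_scaleDl.

Lemma mcoeffP a g h k : (a *: g + h)@_k = a * g@_k + h@_k.
Proof. by rewrite mcoeffD freemod_scaleE. Qed.

End FreeModule.

Section Quotient.
Variables (R : pzRingType) (M : lmodType R) (S : M -> Prop).

(** The submodule generated by [S] is made of the finite linear combinations
    of its elements; membership is decided classically. *)
Inductive span : M -> Prop :=
| span_gen x : S x -> span x
| span0 : span 0
| spanP a x y : span x -> span y -> span (a *: x + y).

Definition submod : {pred M} := fun x => `[< span x >].

Lemma submodP x : reflect (span x) (x \in submod).
Proof. exact: asboolP. Qed.

Lemma submod_closed_subproof : GRing.submod_closed submod.
Proof.
split=> [|a x y /submodP Sx /submodP Sy]; apply/submodP; first exact: span0.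
exact: spanP.
Qed.

HB.instance Definition _ := GRing.isSubmodClosed.Build R M submod
  submod_closed_subproof.

Definition quotmod : Type := Quotient.quot submod.

HB.instance Definition _ := ZmodQuotient.on quotmod.

Definition quotmod_scale (a : R) (x : quotmod) : quotmod := \pi_quotmod (a *: repr x).

Lemma pi_scale a : {morph \pi_quotmod : x / a *: x >-> quotmod_scale a x}.
Proof.
move=> x; apply/eqP; rewrite -Quotient.idealrBE -scalerBr.
by apply: rpredZ; rewrite Quotient.idealrBE reprK.
Qed.

Lemma quotmod_scaleA a b x :
  quotmod_scale a (quotmod_scale b x) = quotmod_scale (a * b) x.
Proof. by rewrite -[x]reprK -!pi_scale scalerA !reprK. Qed.

Lemma quotmod_scale1 : left_id 1 quotmod_scale.
Proof. by move=> x; rewrite -[x]reprK -pi_scale scale1r. Qed.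

Lemma quotmod_scaleDr : right_distributive quotmod_scale +%R.
Proof.
move=> a x y; rewrite -[x]reprK -[y]reprK.
by rewrite -raddfD -!pi_scale scalerDr raddfD.
Qed.

Lemma quotmod_scaleDl x : {morph quotmod_scale^~ x : a b / a + b}.
Proof. by move=> a b; rewrite -[x]reprK -!pi_scale scalerDl raddfD. Qed.

HB.instance Definition _ := GRing.Zmodule_isLmodule.Build R quotmod
  quotmod_scaleA quotmod_scale1 quotmod_scaleDr quotmod_scaleDl.

Definition quot_class (x : M) : quotmod := \pi_quotmod x.

Lemma quot_class_linear : linear quot_class.
Proof. by move=> a x y; rewrite /quot_class raddfD /= pi_scale. Qed.

HB.instance Definition _ := GRing.isLinear.Build R M quotmod *:%R quot_class
  quot_class_linear.

Lemma quot_class_eq0 x : (quot_class x == 0) = (x \in submod).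
Proof.
by rewrite -[x in RHS]subr0 Quotient.idealrBE raddf0.
Qed.

End Quotient.

Definition dual (R : comPzRingType) (M : lmodType R) : Type :=
  {linear M -> R^o}.

Definition dual_fun (R : comPzRingType) (M : lmodType R) (f : dual M) :
  {linear M -> R^o} := f.

Section Dual.
Variables (R : comPzRingType) (M : lmodType R).
Implicit Types (f g h : dual M) (a b : R) (x : M).

HB.instance Definition _ := gen_eqMixin (dual M).
HB.instance Definition _ := gen_choiceMixin (dual M).

Lemma dualP f g : dual_fun f =1 dual_fun g -> f = g.
Proof.
case: f g => [f [[f1] [f2]]] [g [[g1] [g2]]] /= /funext fg.
move: f1 f2; rewrite {}[f]fg => f1 f2.
by rewrite (Prop_irrelevance f1 g1) (Prop_irrelevance f2 g2).
Qed.

Definition dual_zero : dual M := \0.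
Definition dual_opp f : dual M := \- dual_fun f.
Definition dual_add f g : dual M := dual_fun f \+ dual_fun g.
Definition dual_scale a f : dual M := a \*: dual_fun f.

Lemma dual_addA : associative dual_add.
Proof. by move=> f g h; apply: dualP => x /=; rewrite addrA. Qed.

Lemma dual_addC : commutative dual_add.
Proof. by move=> f g; apply: dualP => x /=; rewrite addrC. Qed.

Lemma dual_add0 : left_id dual_zero dual_add.
Proof. by move=> f; apply: dualP => x /=; rewrite add0r. Qed.

Lemma dual_addN : left_inverse dual_zero dual_opp dual_add.
Proof. by move=> f; apply: dualP => x /=; rewrite addNr. Qed.

HB.instance Definition _ :=
  GRing.isZmodule.Build (dual M) dual_addA dual_addC dual_add0 dual_addN.

Lemma dual_scaleA a b f : dual_scale a (dual_scale b f) = dual_scale (a * b) f.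
Proof. by apply: dualP => x /=; rewrite scalerA. Qed.

Lemma dual_scale1 : left_id 1 dual_scale.
Proof. by move=> f; apply: dualP => x /=; rewrite scale1r. Qed.

Lemma dual_scaleDr : right_distributive dual_scale +%R.
Proof. by move=> a f g; apply: dualP => x /=; rewrite scalerDr. Qed.

Lemma dual_scaleDl f : {morph dual_scale^~ f : a b / a + b}.
Proof. by move=> a b; apply: dualP => x /=; rewrite scalerDl. Qed.

HB.instance Definition _ := GRing.Zmodule_isLmodule.Build R (dual M)
  dual_scaleA dual_scale1 dual_scaleDr dual_scaleDl.

End Dual.

Record pairing (R : comPzRingType) (M N : lmodType R) := Pairing {
  pairing_fun :> M -> N -> R^o;
  pairing_linl : forall y, linear (pairing_fun^~ y);
  pairing_linr : forall x, linear (pairing_fun x)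
}.

Section Pairing.
Variables (R : comPzRingType) (M N : lmodType R) (B : pairing M N).

Definition pairingr (y : N) : M -> R^o := fun x => B x y.

HB.instance Definition _ x :=
  GRing.isLinear.Build R N R^o *:%R (B x) (pairing_linr B x).
HB.instance Definition _ y :=
  GRing.isLinear.Build R M R^o *:%R (pairingr y) (pairing_linl B y).

Definition adjl (x : M) : dual N := B x.
Definition adjr (y : N) : dual M := pairingr y.

Lemma adjl_linear : linear adjl.
Proof. by move=> a x x'; apply: dualP => y /=; exact: pairing_linl. Qed.

Lemma adjr_linear : linear adjr.
Proof. by move=> a y y'; apply: dualP => x /=; exact: pairing_linr. Qed.

HB.instance Definition _ :=
  GRing.isLinear.Build R M (dual N) *:%R adjl adjl_linear.
HB.instance Definition _ :=
  GRing.isLinear.Build R N (dual M) *:%R adjr adjr_linear.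

(** [adjl] and [adjr] are linear, so bijectivity makes them isomorphisms. *)
Definition perfect : Prop := bijective adjl /\ bijective adjr.

End Pairing.

Section BilinearExtension.
Variables (R : comPzRingType) (K L : choiceType) (f : K -> L -> R).
Local Open Scope fset_scope.

Definition bilin_fun (g : freemod R K) (h : freemod R L) : R^o :=
  \sum_(k <- msupp g) \sum_(l <- msupp h) g@_k * h@_l * f k l.

Lemma bilin_funE (d : {fset K}) (e : {fset L}) g h :
  msupp g `<=` d -> msupp h `<=` e ->
  bilin_fun g h = \sum_(k <- d) \sum_(l <- e) g@_k * h@_l * f k l.
Proof.
move=> gd he; rewrite /bilin_fun (big_fset_incl _ gd) /=.
  apply: eq_bigr => k _; apply: big_fset_incl => // l _ /mcoeff_outdom ->.
  by rewrite mulr0 mul0r.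
by move=> k _ /mcoeff_outdom ->; apply: big1 => l _; rewrite !mul0r.
Qed.

Lemma bilin_fun_linl h : linear (bilin_fun^~ h).
Proof.
move=> a g g'; set d := msupp g `|` msupp g' `|` msupp (a *: g + g').
rewrite /= !(@bilin_funE d (msupp h)) ?fsubset_refl //; first last.
- by rewrite fsubsetUr.
- by rewrite /d -fsetUA fsubsetUl.
- by rewrite /d fsetUAC fsubsetUr.
rewrite scaler_sumr -big_split; apply: eq_bigr => k _ /=.
rewrite scaler_sumr -big_split; apply: eq_bigr => l _ /=.
by rewrite mcoeffP !mulrDl /GRing.scale /= !mulrA.
Qed.

Lemma bilin_fun_linr g : linear (bilin_fun g).
Proof.
move=> a h h'; set e := msupp h `|` msupp h' `|` msupp (a *: h + h').
rewrite /= !(@bilin_funE (msupp g) e) ?fsubset_refl //; first last.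
- by rewrite fsubsetUr.
- by rewrite /e -fsetUA fsubsetUl.
- by rewrite /e fsetUAC fsubsetUr.
rewrite scaler_sumr -big_split; apply: eq_bigr => k _ /=.
rewrite scaler_sumr -big_split; apply: eq_bigr => l _ /=.
rewrite mcoeffP mulrDr mulrDl /GRing.scale /= !mulrA.
by rewrite (mulrC g@_k a).
Qed.

Definition bilin_ext : pairing (freemod R K) (freemod R L) :=
  Pairing bilin_fun_linl bilin_fun_linr.

Lemma bilin_ext_gen k l : bilin_ext (gen R k) (gen R l) = f k l.
Proof.
rewrite /= (@bilin_funE [fset k] [fset l]) ?msuppU_le //.
by rewrite !big_seq_fset1 !mcoeffUU !mul1r.
Qed.

End BilinearExtension.

(** An isotopy class of planar trivalent rooted trees with leaves labeled by
    [L] is a bracket expression in elements of [L]. *)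

Inductive bracket (L : Type) : Type :=
| Leaf of L
| Node of bracket L & bracket L.

Arguments Leaf {L} _.

Section BracketChoice.
Variable L : choiceType.

Fixpoint bracket_encode (t : bracket L) : GenTree.tree L :=
  match t with
  | Leaf x => GenTree.Leaf x
  | Node a b => GenTree.Node 0 [:: bracket_encode a; bracket_encode b]
  end.

Fixpoint bracket_decode (t : GenTree.tree L) : option (bracket L) :=
  match t with
  | GenTree.Leaf x => Some (Leaf x)
  | GenTree.Node _ [:: a; b] =>
      if (bracket_decode a, bracket_decode b) is (Some a', Some b')
      then Some (Node a' b') else None
  | _ => None
  end.

Lemma bracket_encodeK : pcancel bracket_encode bracket_decode.
Proof. by elim=> //= a -> b ->. Qed.

HB.instance Definition _ := Choice.copy (bracket L) (pcan_type bracket_encodeK).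

End BracketChoice.

Fixpoint leaves (L : Type) (t : bracket L) : seq L :=
  match t with
  | Leaf x => [:: x]
  | Node a b => leaves a ++ leaves b
  end.

Record tree (n : nat) := Tree {
  tree_val :> bracket 'I_n;
  _ : perm_eq (leaves tree_val) (enum 'I_n)
}.

HB.instance Definition _ n := [isSub for @tree_val n].
HB.instance Definition _ n := [Choice of tree n by <:].

(** A vertex other than the root is encoded by its address: the sequence of
    left ([false]) and right ([true]) turns leading to it. The root itself,
    joined by an edge to the vertex of address [[::]], lies on no path between
    two leaves and is not represented, but it is counted in [height]. *)

Fixpoint subtree (L : Type) (t : bracket L) (w : seq bool) :
    option (bracket L) :=
  match w, t with
  | [::], _ => Some t
  | b :: w', Node l r => subtree (if b then r else l) w'
  | _ :: _, Leaf _ => None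
  end.

Fixpoint addresses (L : Type) (t : bracket L) : seq (seq bool) :=
  match t with
  | Leaf _ => [:: [::]]
  | Node l r => [::] :: [seq false :: w | w <- addresses l]
                     ++ [seq true :: w | w <- addresses r]
  end.

Definition vertex (L : Type) (t : bracket L) : finType := seq_sub (addresses t).

Lemma top_subproof (L : Type) (t : bracket L) : [::] \in addresses t.
Proof. by case: t. Qed.

Definition top (L : Type) (t : bracket L) : vertex t :=
  SeqSub (top_subproof t).

Definition height (L : Type) (t : bracket L) (v : vertex t) : nat :=
  (size (val v)).+1.

Definition adjacent (L : Type) (t : bracket L) : rel (vertex t) :=
  fun u v => [exists b : bool,
    (val v == rcons (val u) b) || (val u == rcons (val v) b)].

Definition internal (L : Type) (t : bracket L) (v : vertex t) : bool :=
  if subtree t (val v) is Some (Node _ _) then true else false.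

Definition leaf_vertex (L : choiceType) (t : bracket L) (i : L) : vertex t :=
  odflt (top t) [pick v : vertex t | subtree t (val v) == Some (Leaf i)].

(** [shortest_path e x y] is the list of all vertices, including [x] and [y],
    on a walk of minimal length from [x] to [y]. *)

Section ShortestPath.
Variables (V : finType) (e : rel V).

Definition walk (x y : V) (p : seq V) : bool := path e x p && (last x p == y).

Definition distance (x y : V) : nat :=
  find (fun k => [exists p : k.-tuple V, walk x y p]) (iota 0 #|V|).

Definition shortest_path (x y : V) : seq V :=
  if [pick p : (distance x y).-tuple V | walk x y p] is Some p
  then x :: p else [::].

End ShortestPath.

Definition tree_path (n : nat) (t : tree n) (i j : 'I_n) : seq (vertex t) :=
  shortest_path (@adjacent _ t) (leaf_vertex t i) (leaf_vertex t j).

Definition nadir (n : nat) (t : tree n) (i j : 'I_n) : vertex t :=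
  [arg min_(v < leaf_vertex t i | v \in tree_path t i j) height v]%N.

Definition left_to_right (n : nat) (t : tree n) (i j : 'I_n) : bool :=
  let w := val (nadir t i j) in
  infix [:: rcons w false; w; rcons w true] (map val (tree_path t i j)).

(** A graph with oriented, possibly multiple edges on the vertex set ['I_n] is
    given, up to renaming of its edges, by the number of edges [i -> j] for
    each ordered pair [(i, j)]. *)

Notation arrows n := {ffun 'I_n * 'I_n -> nat}.

Definition joined (n : nat) (m : arrows n) : rel 'I_n :=
  fun i j => (0 < m (i, j))%N || (0 < m (j, i))%N.

Definition loopless (n : nat) (m : arrows n) : bool :=
  [forall i, m (i, i) == 0%N].

Definition connected (n : nat) (m : arrows n) : bool :=
  [forall i, forall j, connect (joined m) i j].

Record graph (n : nat) := Graph {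
  graph_val :> arrows n;
  _ : loopless graph_val && connected graph_val
}.

HB.instance Definition _ n := [isSub for @graph_val n].
HB.instance Definition _ n := [Choice of graph n by <:].

Definition edge (n : nat) (G : graph n) : finType :=
  {a : 'I_n * 'I_n & 'I_(G a)}.

Definition source (n : nat) (G : graph n) (e : edge G) : 'I_n := (tag e).1.
Definition target (n : nat) (G : graph n) (e : edge G) : 'I_n := (tag e).2.

Section ConfigurationPairing.
Variables (n : nat) (G : graph n) (T : tree n).

Definition beta (e : edge G) : vertex T := nadir T (source e) (target e).

(** [beta] takes its values in the type of all vertices; it must be injective
    with image exactly the set of internal vertices. *)
Definition beta_bij : bool :=
  injectiveb beta && [forall v, (v \in codom beta) == internal v].

Definition nb_left_to_right : nat :=
  #|[set e : edge G | left_to_right T (source e) (target e)]|.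

Definition config (R : pzRingType) : R :=
  if beta_bij then (-1) ^+ nb_left_to_right else 0.

End ConfigurationPairing.

Section LieEil.
Variables (R : comPzRingType) (n : nat).

Definition Theta := freemod R (tree n).
Definition Gamma := freemod R (graph n).

Definition config_pairing : pairing Gamma Theta :=
  bilin_ext (fun G T => config G T R).

(** A tree with a hole, from the root down; [(b, s)] stands for an internal
    vertex whose [b]-branch leads to the hole and whose other branch is [s]. *)
Fixpoint plug (c : seq (bool * bracket 'I_n)) (t : bracket 'I_n) :
    bracket 'I_n :=
  match c with
  | [::] => t
  | (b, s) :: c' => if b then Node s (plug c' t) else Node (plug c' t) s
  end.

Definition jacobi (x : Theta) : Prop :=
  exists c A B C (T1 T2 T3 : tree n),
    [/\ T1 = plug c (Node (Node A B) C) :> bracket 'I_n,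
        T2 = plug c (Node (Node C A) B) :> bracket 'I_n,
        T3 = plug c (Node (Node B C) A) :> bracket 'I_n &
        x = gen R T1 + gen R T2 + gen R T3].

(** [tree_iso t t' k]: there is an isomorphism of (rooted, labeled) graphs from
    [t] to [t'] exchanging left and right at exactly [k] internal vertices. *)
Inductive tree_iso : bracket 'I_n -> bracket 'I_n -> nat -> Prop :=
| iso_leaf i : tree_iso (Leaf i) (Leaf i) 0
| iso_keep a a' b b' k l : tree_iso a a' k -> tree_iso b b' l ->
    tree_iso (Node a b) (Node a' b') (k + l)
| iso_swap a a' b b' k l : tree_iso a a' k -> tree_iso b b' l ->
    tree_iso (Node a b) (Node b' a') (k + l).+1.

Definition tree_symmetry (x : Theta) : Prop :=
  exists T1 T2 : tree n, tree_iso T1 T2 1 /\ x = gen R T1 + gen R T2.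

Definition J_rel (x : Theta) : Prop := jacobi x \/ tree_symmetry x.

Definition add_arrow (m : arrows n) (i j : 'I_n) : arrows n :=
  [ffun a => m a + (a == (i, j))]%N.

Definition arnold (x : Gamma) : Prop :=
  exists m i j k (G1 G2 G3 : graph n),
    [/\ [/\ i != j, j != k & k != i],
        G1 = add_arrow (add_arrow m i j) j k :> arrows n,
        G2 = add_arrow (add_arrow m j k) k i :> arrows n,
        G3 = add_arrow (add_arrow m k i) i j :> arrows n &
        x = gen R G1 + gen R G2 + gen R G3].

Definition graph_symmetry (x : Gamma) : Prop :=
  exists m i j (G1 G2 : graph n),
    [/\ G1 = add_arrow m i j :> arrows n, G2 = add_arrow m j i :> arrows n &
        x = gen R G1 + gen R G2].

Definition multi_edge (x : Gamma) : Prop :=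
  exists (G : graph n) (e e' : edge G),
    [/\ e != e', [set source e; target e] = [set source e'; target e'] &
        x = gen R G].

Definition I_rel (x : Gamma) : Prop :=
  [\/ arnold x, graph_symmetry x | multi_edge x].

Definition J_sub : {pred Theta} := submod J_rel.
Definition I_sub : {pred Gamma} := submod I_rel.

Definition Lie := quotmod J_rel.
Definition Eil := quotmod I_rel.

End LieEil.

Arguments config_pairing R n : clear implicits.
Arguments J_rel R n : clear implicits.
Arguments I_rel R n : clear implicits.
Arguments J_sub R n : clear implicits.
Arguments I_sub R n : clear implicits.
Arguments quot_class {R M} S x.

(* Main.v *)
(** The sign of the pairing factors over the internal vertices of the tree:
    <G, T> is the product, over the vertices with left and right branches [l]
    and [r], of a sign that is nonzero only if exactly one edge of [G] joins the
    leaves of [l] to those of [r]. All the relations follow from this product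
    formula.

    Fix a label [o]. Jacobi and antisymmetry reduce every tree to left-normed
    brackets [[..[o, v_k], ..], v_1]; Arnold and the other graph relations reduce
    every graph to paths o -> v_k -> .. -> v_1. The product formula shows
    that these two spanning families, both indexed by the orderings of the labels
    other than [o], are dual to each other up to a global sign. Hence they are
    bases, and the pairing is perfect. *)

Require Import Defs.
From mathcomp Require Import all_boot all_order all_algebra.
From mathcomp Require Import finmap monalg.
From mathcomp Require Import zify.
From mathcomp.algebra_tactics Require Import ring.
Import GRing.Theory.

Set Implicit Arguments.
Unset Strict Implicit.
Unset Printing Implicit Defensive.

(** * Geodesics between addresses *)

(** The pairing is defined through a chosen walk of minimal length between two leaves, so the
    product formula needs such walks to be unique. On addresses this is explicit: a geodesic climbs
    to the longest common prefix and descends again. That prefix is the nadir, and it is also the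
    only internal vertex having the two leaves in different branches. Bijectivity of [beta] then
    splits into one condition per internal vertex.

    The formula is stated for arbitrary arrow tables and brackets, because inductions pass to
    subtrees carrying only part of the labels and to tables that need not be connected.

    For duality, the leaf attached last in a left-normed bracket must be the end of the path
    opposite to [o]: otherwise it is interior to the path and two edges cross the top vertex.
    Peeling it off forces the two orderings to agree. Each of the n-1 edges is then travelled from
    left to right, hence the global sign (-1)^(n-1). This sign is its own inverse, so both adjoints
    get an explicit inverse over any commutative ring. *)

Definition neighbor (u v : seq bool) : bool :=
  [exists b : bool, (v == rcons u b) || (u == rcons v b)].

Lemma neighborC u v : neighbor u v = neighbor v u.
Proof. by apply: eq_existsb => b; rewrite orbC. Qed.

Lemma neighbor_nil u : neighbor [::] u = (size u == 1).
Proof.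
apply/existsP/idP => [[b /orP[/eqP -> //|]]|]; first by case: u.
by case: u => [|b []] //= _; exists b; rewrite eqxx.
Qed.

Lemma neighbor_cons b c u v : neighbor (b :: u) (c :: v) =
  (b == c) && neighbor u v.
Proof.
apply/existsP/andP => [[d]|[/eqP -> /existsP[d uv]]].
  case/orP=> /eqP[-> ->]; split=> //; apply/existsP; exists d; rewrite eqxx ?orbT //.
by exists d; rewrite /= !eqseq_cons !eqxx.
Qed.

(** [climb u] runs from [u] up to [[::]]; [descent u] runs from [[::]],
    excluded, down to [u]. *)
Fixpoint climb (u : seq bool) : seq (seq bool) :=
  if u is b :: u' then rcons [seq b :: w | w <- climb u'] [::] else [:: [::]].

Fixpoint descent (u : seq bool) : seq (seq bool) :=
  if u is b :: u' then [:: b] :: [seq b :: w | w <- descent u'] else [::].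

Fixpoint geodesic (u v : seq bool) : seq (seq bool) :=
  match u, v with
  | b :: u', c :: v' => if b == c then [seq b :: w | w <- geodesic u' v']
                        else climb u ++ descent v
  | _, _ => climb u ++ descent v
  end.

Fixpoint geodist (u v : seq bool) : nat :=
  match u, v with
  | b :: u', c :: v' => if b == c then geodist u' v' else size u + size v
  | _, _ => size u + size v
  end.

Lemma size_climb u : size (climb u) = (size u).+1.
Proof. by elim: u => //= b u IH; rewrite size_rcons size_map IH. Qed.

Lemma size_descent u : size (descent u) = size u.
Proof. by elim: u => //= b u IH; rewrite size_map IH. Qed.

Lemma size_geodesic u v : size (geodesic u v) = (geodist u v).+1.
Proof.
elim: u v => [|b u IH] [|c v] //=; rewrite ?size_map ?size_descent //.
  by rewrite size_cat size_rcons size_map size_climb //=.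
case: eqP => _; first by rewrite size_map IH.
by rewrite size_cat /= size_rcons !size_map size_climb size_descent.
Qed.

Lemma climbE u : climb u = rev ([::] :: descent u).
Proof.
by elim: u => //= b u ->; rewrite map_rev [RHS]rev_cons.
Qed.

(** One step gains at most one unit of distance to [v]. The equality case identifies the step as the
    first one of the geodesic, which is what makes minimal walks unique. *)
Lemma geodesic_step u u' v : neighbor u u' ->
  geodist u v <= (geodist u' v).+1 /\
  (geodist u v = (geodist u' v).+1 -> geodesic u v = u :: geodesic u' v).
Proof.
elim: u u' v => [|b u IH] [|b' u'] v.
- by rewrite neighbor_nil.
- rewrite neighbor_nil => /eqP[/size0nil ->] {u'}; case: v => [|c v] //=.
  by have [->|] := eqVneq b' c; split=> //; lia.
- rewrite neighborC neighbor_nil => /eqP[/size0nil ->]  {IH}.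
  by case: v => [|c v] //=; have [->|] := eqVneq b c; split=> //; lia.
- rewrite neighbor_cons => /andP[/eqP <- uu'].
  have [climb_le climb_eq] : size u <= (size u').+1 /\
      (size u = (size u').+1 -> climb u = u :: climb u').
    case/existsP: uu' => d /orP[]/eqP ->; rewrite size_rcons; first by split; lia.
    by split=> // _; elim: (u') => //= e w ->.
  case: v => [|c v] /=.
    by rewrite !addn0 !cats0; split=> [|[/climb_eq -> //]]; lia.
  have [_|_] := eqVneq b c.
    have [le_uu' geo_u] := IH _ v uu'; split=> // /geo_u -> //=.
  by split=> [|E]; [lia|rewrite climb_eq //=; lia].
Qed.

(** A walk of length [geodist u v] must gain one unit at every step, so [geodesic_step] determines
    it step by step. *)
Lemma geodesic_unique u v p : path neighbor u p -> last u p = v ->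
  geodist u v <= size p /\ (size p = geodist u v -> u :: p = geodesic u v).
Proof.
elim: p u => [|u' p IH] u /=.
  move=> _ <-; split; last by elim: u => //= b u IH; rewrite eqxx => /IH <-.
  by elim: u => //= b u; rewrite eqxx.
case/andP=> uu' pathp lastp; have [dp geop] := IH _ pathp lastp.
have [du geou] := geodesic_step v uu'.
split; first by lia.
by move=> Ep; rewrite geou; [rewrite -geop //; lia|lia].
Qed.

Lemma sorted_geodesic u v : sorted neighbor (geodesic u v).
Proof.
have down w : path neighbor [::] (descent w).
  elim: w => //= b w IH; rewrite neighbor_nil /= path_map.
  by rewrite (eq_path (e' := neighbor)) // => x y /=; rewrite neighbor_cons eqxx.
have updown w w' : sorted neighbor (climb w ++ descent w').
  rewrite climbE rev_cons cat_rcons sorted_cat_cons -rev_cons rev_sorted /= down.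
  by rewrite andbT (eq_path (e' := neighbor)) // => x y; rewrite neighborC.
elim: u v => [|b u IH] [|c v]; try exact: updown.
rewrite /=; case: eqP => _; last exact: (updown (b :: u) (c :: v)).
rewrite sorted_map (eq_sorted (e' := neighbor)) // => x y /=.
by rewrite neighbor_cons eqxx.
Qed.

Lemma geodesic_ends u v :
  exists p, [/\ geodesic u v = u :: p, last u p = v & size p = geodist u v].
Proof.
have up w : climb w = w :: behead (climb w) by elim: w => //= b w ->.
have lastup w : last w (behead (climb w)) = [::].
  have: last [::] (climb w) = [::] by rewrite climbE rev_cons last_rcons.
  by rewrite up.
have lastdown w w' : last w (descent w') = if w' is [::] then w else w'.
  by elim: w' w => //= b w' IH w; rewrite last_map IH; case: w' {IH}.
have main : head [::] (geodesic u v) = u /\ last [::] (geodesic u v) = v.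
  elim: u v => [|b u IH] [|c v] //=.
  - by split=> //; rewrite last_map lastdown; case: v.
  - by rewrite cats0 last_rcons up.
  - case: eqP => [<-|_]; last first.
      by rewrite last_cat /= last_map lastdown up; split=> //; case: v {IH}.
    have := IH v; case: (geodesic u v) (size_geodesic u v) => //= x p _ [->].
    by rewrite last_map => ->.
have := size_geodesic u v; case: (geodesic u v) main => //= x p [-> lastp] [sp].
by exists p.
Qed.

(** Addresses of a tree are closed under prefixes, so this keeps a geodesic between two vertices
    inside the tree. *)
Lemma mem_geodesic u v w :
  w \in geodesic u v -> prefix w u || prefix w v.
Proof.
have down x y : y \in descent x -> prefix y x.
  elim: x y => //= b x IH y; rewrite inE => /predU1P[->|/mapP[z /IH zx ->]].
    by rewrite /= eqxx prefix0s.
  by rewrite /= eqxx.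
have updown x y z : z \in climb x ++ descent y -> prefix z x || prefix z y.
  rewrite mem_cat climbE mem_rev inE => /orP[/predU1P[->|]|].
  - by rewrite prefix0s.
  - by move/down ->.
  - by move/down ->; rewrite orbT.
elim: u v w => [|b u IH] [|c v] w; try exact: updown.
rewrite /=; case: eqP => [<-|_]; last exact: updown (b :: u) (c :: v) w.
by case/mapP=> x xuv ->; rewrite /= eqxx IH.
Qed.

(** The addresses split at [w]. The size bound makes [w] the unique lowest vertex of the path, and
    the middle triple shows the direction of travel there. *)
Lemma geodesic_fork w b u v :
  exists p q, geodesic (w ++ b :: u) (w ++ ~~ b :: v) =
    p ++ [:: rcons w b; w; rcons w (~~ b)] ++ q /\
    {in p ++ rcons w b :: rcons w (~~ b) :: q, forall x, size w < size x}.
Proof.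
elim: w => [|c w [p [q [Epq lt_w]]]] /=; last first.
  exists [seq c :: x | x <- p], [seq c :: x | x <- q]; rewrite eqxx Epq map_cat.
  split=> // x; rewrite -!map_cons -map_cat.
  by case/mapP=> y /lt_w lt_wy -> /=.
exists [seq b :: x | x <- rev (descent u)], [seq ~~ b :: x | x <- descent v].
rewrite (negPf (_ : b != ~~ b)) ?climbE; last by case: b.
split=> [|x].
  by rewrite rev_cons map_rcons -!cats1 -!catA.
by rewrite mem_cat !inE => /or4P[/mapP[y _ ->]|/eqP->|/eqP->|/mapP[y _ ->]].
Qed.

(** * The nadir of a path in a tree *)

Section Subtree.
Variable L : choiceType.
Implicit Types (t : bracket L) (w : seq bool).

Lemma mem_addresses t w : (w \in addresses t) = (subtree t w != None).
Proof.
have cons_in b s v : ([:: b & v] \in [seq b :: x | x <- s]) = (v \in s).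
  by rewrite mem_map // => x y [].
elim: t w => [x|l IHl r IHr] [|b w] //=.
rewrite inE /= mem_cat; case: b; rewrite cons_in -?IHl -?IHr.
  by rewrite [X in X || _](negPf _) //; apply/mapP=> [[]].
by rewrite [X in _ || X](negPf _) ?orbF //; apply/mapP=> [[]].
Qed.

Lemma subtree_cat t w w' :
  subtree t (w ++ w') = obind (fun s => subtree s w') (subtree t w).
Proof. by elim: w t => [|b w IH] [x|l r] //=; case: w' {IH}. Qed.

Lemma addresses_prefix t w w' :
  prefix w w' -> w' \in addresses t -> w \in addresses t.
Proof.
case/prefixP=> s ->; rewrite !mem_addresses subtree_cat.
by case: (subtree t w).
Qed.

Lemma subtree_leaves t w s : subtree t w = Some s -> {subset leaves s <= leaves t}.
Proof.
elim: t w => [x|l IHl r IHr] [|b w] //=; try by case=> <-.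
case: b => [/IHr|/IHl] sub x /sub; rewrite mem_cat => ->//.
by rewrite orbT.
Qed.

Lemma leaf_address t i :
  i \in leaves t -> exists w, subtree t w = Some (Leaf i).
Proof.
elim: t => [x|l IHl r IHr] /=; first by rewrite inE => /eqP ->; exists [::].
by rewrite mem_cat => /orP[/IHl|/IHr] [w ?]; [exists (false :: w)|exists (true :: w)].
Qed.

Lemma subtree_uniq t w s : uniq (leaves t) -> subtree t w = Some s -> uniq (leaves s).
Proof.
elim: t w => [x|l IHl r IHr] [|[] w] //=; try by move=> ? [<-].
  by rewrite cat_uniq => /and3P[_ _ /IHr]; apply.
by rewrite cat_uniq => /and3P[/IHl + _ _]; apply.
Qed.

(** A description of the nadir that mentions no path, symmetric in [i] and [j]. *)
Definition separates t w (i j : L) : bool :=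
  if subtree t w is Some (Node l r)
  then (i \in leaves l) && (j \in leaves r) || (i \in leaves r) && (j \in leaves l)
  else false.

Lemma separates_leaves t w i j :
  separates t w i j -> (i \in leaves t) && (j \in leaves t).
Proof.
rewrite /separates; case E: (subtree t w) => [[//|l r]|//].
have := subtree_leaves E => /= sub.
by case/orP=> /andP[iP jP]; rewrite !sub // mem_cat ?iP ?jP ?orbT.
Qed.

(** A vertex strictly below a separating one sees only the labels of one of its branches, hence not
    both [i] and [j]. *)
Lemma separates_unique t w w' i j : uniq (leaves t) ->
  separates t w i j -> separates t w' i j -> w = w'.
Proof.
elim: t w w' => [x|l IHl r IHr] w w'; first by case: w.
rewrite /= cat_uniq => /and3P[ul dlr ur].
have disj x : x \in leaves l -> x \in leaves r -> False.
  by move=> xl xr; move/hasPn: dlr => /(_ x xr) /=; rewrite xl.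
have sep_cons b v : separates (Node l r) (b :: v) i j =
    separates (if b then r else l) v i j by [].
have sep_nil b v : separates (Node l r) [::] i j ->
    separates (if b then r else l) v i j -> False.
  move=> + /separates_leaves/andP[]; rewrite /separates /=.
  by case: b => /orP[]/andP[i1 j1] i2 j2;
    solve [exact: disj i1 i2|exact: disj j1 j2|exact: disj i2 i1|exact: disj j2 j1].
case: w w' => [|b w] [|b' w'] //; rewrite ?sep_cons => s1 s2.
- by case: (sep_nil _ _ s1 s2).
- by case: (sep_nil _ _ s2 s1).
have /andP[i1 _] := separates_leaves s1; have /andP[i2 _] := separates_leaves s2.
case: b b' s1 s2 i1 i2 => [] [] s1 s2 i1 i2.
- by rewrite (IHr _ _ ur s1 s2).
- by case: (disj i).
- by case: (disj i).
- by rewrite (IHl _ _ ul s1 s2).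
Qed.

(** A leaf has no proper subtree, so neither address is a prefix of the other and they must
    diverge. *)
Lemma address_fork t w w' i j : i != j ->
  subtree t w = Some (Leaf i) -> subtree t w' = Some (Leaf j) ->
  exists v b u u', w = v ++ b :: u /\ w' = v ++ ~~ b :: u'.
Proof.
elim: t w w' => [x|l IHl r IHr] [|b w] [|b' w'] //=.
  by move=> /eqP ij [xi] [xj]; case: ij; rewrite -xi.
move=> ij; have [<-|bb'] := eqVneq b b'; last first.
  by move=> _ _; exists [::], b, w, w'; case: b b' bb' => [] [].
by case: b => [/(IHr _ _ ij) H /H|/(IHl _ _ ij) H /H] [v [b [u [u' [-> ->]]]]];
  [exists (true :: v)|exists (false :: v)]; exists b, u, u'.
Qed.

End Subtree.

Lemma shortest_pathE (V : finType) (e : rel V) x y p :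
    path e x p -> last x p = y ->
    (forall q, path e x q -> last x q = y ->
       size p <= size q /\ (size q = size p -> q = p)) ->
  shortest_path e x y = x :: p.
Proof.
move=> xp lp min_p.
(* [distance] searches lengths below [#|V|] only; a minimal walk is that short because cutting out
   its cycles leaves a walk without repetition. *)
have lt_p : size p < #|V|.
  have := min_p; rewrite -lp; case: (shortenP xp) => q xq uq _ min_q.
  have [//|/leq_ltn_trans-> //] := min_q _ xq.
  by have /card_uniqP/= <- := uq; apply: max_card.
have dist_p : distance e x y = size p.
  rewrite /distance; set a := (fun k => _).
  have ap : a (size p).
    by apply/existsP; exists (in_tuple p); rewrite /walk xp lp eqxx.
  have lt_find : find a (iota 0 #|V|) < #|V|.
    by rewrite -[X in _ < X](size_iota 0) -has_find; apply/hasP; exists (size p); rewrite ?mem_iota.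
  apply/eqP; rewrite eqn_leq; apply/andP; split.
    rewrite leqNgt; apply/negP => /(before_find 0).
    by rewrite nth_iota ?add0n ?ap.
  have := nth_find 0 (_ : has a (iota 0 #|V|)); rewrite has_find size_iota lt_find.
  move=> /(_ isT); rewrite nth_iota // add0n => /existsP[q /andP[xq /eqP lq]].
  by have [+ _] := min_p _ xq lq; rewrite size_tuple.
rewrite /shortest_path; case: pickP => [q /andP[xq /eqP lq]|none].
  have [_ ->//] := min_p _ xq lq; by rewrite size_tuple.
have sp : size p == distance e x y by rewrite dist_p.
by have := none (Tuple sp); rewrite /walk /= xp lp eqxx.
Qed.

Section Nadir.
Variables (n : nat) (t : tree n).

Lemma tree_leaves_uniq : uniq (leaves t).
Proof. by case: t => s /= /perm_uniq ->; rewrite enum_uniq. Qed.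

Lemma mem_tree_leaves i : i \in leaves t.
Proof. by case: t => s /= /perm_mem ->; rewrite mem_enum. Qed.

Lemma leaf_vertexP i : subtree t (val (leaf_vertex t i)) = Some (Leaf i).
Proof.
rewrite /leaf_vertex; case: pickP => [v /eqP //|none].
have [w Ew] := leaf_address (mem_tree_leaves i).
have wP : w \in addresses t by rewrite mem_addresses Ew.
by have := none (SeqSub wP); rewrite /= Ew eqxx.
Qed.

Lemma tree_path_geodesic i j : map val (tree_path t i j) =
  geodesic (val (leaf_vertex t i)) (val (leaf_vertex t j)).
Proof.
set x := leaf_vertex t i; set y := leaf_vertex t j.
have adjE (u v : vertex t) : adjacent u v = neighbor (val u) (val v) by [].
have pathE u p : path (@adjacent _ t) u p = path neighbor (val u) (map val p).
  by rewrite path_map.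
have [p [Ep lp sp]] := geodesic_ends (val x) (val y).
(* The geodesic is a list of addresses; it is lifted to a list of vertices of [t]. *)
have [q Eq] : exists q : seq (vertex t), map val q = p.
  have: {subset p <= addresses t}.
    move=> w wp; have: w \in geodesic (val x) (val y) by rewrite Ep inE wp orbT.
    by case/mem_geodesic/orP => /addresses_prefix; apply; apply: valP.
  elim: p {Ep lp sp} => [|w p IH] sub; first by exists [::].
  have [|q Eq] := IH; first by move=> v vp; rewrite sub // inE vp orbT.
  by exists (SeqSub (sub w (mem_head _ _)) :: q); rewrite /= Eq.
rewrite /tree_path -/x -/y (@shortest_pathE _ _ x y q); first by rewrite /= Eq Ep.
- by rewrite pathE Eq; have := sorted_geodesic (val x) (val y); rewrite Ep.
- by apply: val_inj; rewrite -lp -Eq last_map.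
move=> q' xq' lq'.
rewrite pathE in xq'; have [] := @geodesic_unique _ (val y) _ xq'.
  by rewrite last_map lq'.
rewrite -sp -Eq !size_map => le_q E; split=> // /E.
by rewrite Ep -Eq => -[] /(inj_map val_inj).
Qed.

(** [d] tells whether the path from [i] to [j] starts in the right branch. *)
Lemma nadir_separates i j : i != j -> exists l r (d : bool),
  [/\ subtree t (val (nadir t i j)) = Some (Node l r),
      i \in leaves (if d then r else l), j \in leaves (if d then l else r) &
      left_to_right t i j = ~~ d].
Proof.
move=> ij; have [v [d [u [u' [Ei Ej]]]]] := address_fork ij (leaf_vertexP i) (leaf_vertexP j).
have [p [q [Egeo lt_v]]] := geodesic_fork v d u u'.
have Epath := tree_path_geodesic i j; rewrite Ei Ej Egeo in Epath.
have Enadir : val (nadir t i j) = v.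
  rewrite /nadir; case: arg_minnP => [|w wP min_w].
    rewrite -(mem_map val_inj) tree_path_geodesic.
    set x := val (leaf_vertex t i); set y := val (leaf_vertex t j).
    by have [s [-> _ _]] := geodesic_ends x y; rewrite mem_head.
  have : val w \in map val (tree_path t i j) by rewrite map_f.
  rewrite Epath.
  have -> : (val w \in p ++ [:: rcons v d; v; rcons v (~~ d)] ++ q) =
     (val w == v) || (val w \in p ++ rcons v d :: rcons v (~~ d) :: q).
    by rewrite !mem_cat !inE; case: (_ == v); rewrite /= ?orbT -?orbA.
  case/predU1P=> // /lt_v lt_vw.
  have vP : v \in map val (tree_path t i j) by rewrite Epath mem_cat !inE eqxx !orbT.
  case/mapP: vP => v' v'P Ev; have := min_w _ v'P.
  by rewrite /height -Ev ltnS leqNgt lt_vw.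
have Ltr : left_to_right t i j = ~~ d.
  rewrite /left_to_right Enadir Epath; case: d {Ei Ej Egeo Epath} lt_v => lt_v; last first.
    by apply/infixP; exists p, q.
  (* The address [v] occurs once on the path, so the pattern could only sit around that occurrence,
     where the path arrives from [rcons v true] and not from [rcons v false]. *)
  apply/negP => /infixP[p' [q' E]].
  have vN : v \notin p ++ rcons v true :: rcons v false :: q.
    by apply/negP => /lt_v; rewrite ltnn.
  have [vp vr vr' vq] : [/\ v \notin p, v != rcons v true, v != rcons v false & v \notin q].
    by move: vN; rewrite mem_cat !inE !negb_or => /and4P[].
  have v1 : count_mem v (p' ++ [:: rcons v false; v; rcons v true] ++ q') = 1.
    rewrite -E !count_cat /= eqxx ![_ == v]eq_sym (negPf vr) (negPf vr').
    by rewrite (count_memPn vp) (count_memPn vq).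
  have vp' : v \notin p'.
    by apply/count_memPn; move: v1; rewrite !count_cat /= eqxx; lia.
  have := congr1 (index v) E; rewrite !index_cat (negPf vp) (negPf vp') /= eqxx.
  rewrite !inE eqxx !orbT ![_ == v]eq_sym (negPf vr) (negPf vr') => /addIn sizes.
  have := congr1 (nth [::] ^~ (size p)) E; rewrite {2}sizes !nth_cat !ltnn !subnn /=.
  by move/rcons_inj => -[].
have := leaf_vertexP i; have := leaf_vertexP j; rewrite Ei Ej Enadir Ltr !subtree_cat.
case: (subtree t v) => [[x|l r]|] //= Ej' Ei'; exists l, r, d.
split=> //; first by apply: (subtree_leaves Ei'); rewrite mem_head.
have -> : (if d then l else r) = if ~~ d then r else l by case: (d).
by apply: (subtree_leaves Ej'); rewrite mem_head.
Qed.
End Nadir.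

Local Open Scope ring_scope.

(** * The pairing as a product over internal vertices *)

Section Weight.
Variables (R : comPzRingType) (n : nat).
Implicit Types (m : arrows n) (P Q : seq 'I_n) (t l r : bracket 'I_n).

Definition crossing m P Q : nat := (\sum_(i <- P) \sum_(j <- Q) m (i, j))%N.

(** Here [p] counts the edges crossing a vertex from left to right, and [q] those crossing from
    right to left. *)
Definition node_sign (p q : nat) : R := if (p + q == 1)%N then (-1) ^+ p else 0.

Definition cut_sign m P Q : R := node_sign (crossing m P Q) (crossing m Q P).

Fixpoint weight m t : R :=
  match t with
  | Leaf _ => 1
  | Node l r => weight m l * weight m r * cut_sign m (leaves l) (leaves r)
  end.

Lemma crossingE m P Q : uniq P -> uniq Q ->
  crossing m P Q = (\sum_(a | (a.1 \in P) && (a.2 \in Q)) m a)%N.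
Proof.
move=> uP uQ; rewrite /crossing (big_uniq _ uP).
under eq_bigr => i _ do rewrite (big_uniq _ uQ).
by rewrite pair_big; apply: eq_bigr => -[].
Qed.

Definition vertex_sign m t (w : seq bool) : R :=
  if subtree t w is Some (Node l r) then cut_sign m (leaves l) (leaves r) else 1.

Lemma weightE m t : weight m t = \prod_(w <- addresses t) vertex_sign m t w.
Proof.
elim: t => [x|l IHl r IHr] /=; first by rewrite big_seq1.
by rewrite big_cons big_cat !big_map /= [LHS]mulrC IHl IHr.
Qed.

Lemma addresses_uniq t : uniq (addresses t).
Proof.
elim: t => //= l ul r ur; rewrite cat_uniq !map_inj_uniq ?ul ?ur => [|x y []|x y []] //.
rewrite mem_cat negb_or andbT /=; do !(apply/andP; split).
- by apply/mapP => -[].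
- by apply/mapP => -[].
- by apply/hasPn => _ /mapP[x _ ->]; apply/mapP => -[].
Qed.

Lemma card_edges (G : graph n) (A : pred ('I_n * 'I_n)) :
  #|[set e : edge G | A (tag e)]| = (\sum_(a | A a) G a)%N.
Proof.
rewrite -sum1dep_card; transitivity (\sum_(a | A a) \sum_(j : 'I_(G a)) 1)%N.
  by rewrite sig_big_dep; apply: eq_bigl => e; rewrite andbT.
by apply: eq_bigr => a _; rewrite sum_nat_const card_ord muln1.
Qed.

Variables (G : graph n) (T : tree n).

Lemma edge_neq (e : edge G) : source e != target e.
Proof.
have /andP[/forallP loop_G _] := valP G; case: e => [[i j] k].
rewrite /source /target /=; have: (0 < G (i, j))%N by apply: leq_ltn_trans (ltn_ord k).
by apply: contraTneq => <-; rewrite (eqP (loop_G i)).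
Qed.

Let fiber (v : vertex T) := [set e : edge G | beta T e == v].

Lemma beta_internal (e : edge G) : internal (beta T e).
Proof.
by have [l [r [d [E _ _ _]]]] := nadir_separates T (edge_neq e); rewrite /internal E.
Qed.

Lemma separates_nadir (i j : 'I_n) w :
  i != j -> (separates T w i j) = (val (nadir T i j) == w).
Proof.
move=> ij; have [l [r [d [E il jr _]]]] := nadir_separates T ij.
have sep : separates T (val (nadir T i j)) i j.
  by rewrite /separates E; case: d il jr => -> ->; rewrite ?orbT.
apply/idP/eqP => [|<- //]; exact: (separates_unique (tree_leaves_uniq T)).
Qed.

(** By [separates_nadir], an edge has nadir [v] exactly when its endpoints lie in different branches
    at [v]; it travels from left to right when its source is on the left. *)
Lemma fiber_node (v : vertex T) l r : subtree T (val v) = Some (Node l r) ->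
  #|fiber v| = (crossing G (leaves l) (leaves r) + crossing G (leaves r) (leaves l))%N
  /\ #|[set e in fiber v | left_to_right T (source e) (target e)]|
     = crossing G (leaves l) (leaves r).
Proof.
move=> Ev.
have [ul ur dis] : [/\ uniq (leaves l), uniq (leaves r) &
    forall x, x \in leaves l -> x \in leaves r = false].
  have : uniq (leaves (Node l r)) by apply: subtree_uniq (tree_leaves_uniq T) Ev.
  rewrite /= cat_uniq => /and3P[ul dis ur]; split=> // x xl; apply/negbTE.
  by apply: contra dis => xr; apply/hasP; exists x.
have fiberE (e : edge G) : (beta T e == v) = separates T (val v) (source e) (target e).
  by rewrite separates_nadir ?edge_neq.
split; last first.
  rewrite crossingE // -card_edges; apply: eq_card => e; rewrite !inE fiberE.
  have [l' [r' [d [E il jr ->]]]] := nadir_separates T (edge_neq e).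
  apply/andP/andP => [[]|[il' jr']].
    rewrite separates_nadir ?edge_neq // => /eqP Ev'; move: il jr E; rewrite Ev' Ev.
    by case: d => // il jr [-> ->].
  have sep: separates T (val v) (source e) (target e).
    by rewrite /separates Ev il' jr'.
  split=> //; move: sep; rewrite separates_nadir ?edge_neq // => /eqP Ev'.
  move: il E; rewrite Ev' Ev; case: d {jr} => // ir [_ Er].
  by rewrite -Er dis in ir.
rewrite !crossingE //.
have -> : fiber v = [set e | separates T (val v) (tag e).1 (tag e).2].
  by apply/setP => e; rewrite !inE fiberE.
rewrite (card_edges _ (fun a => separates T (val v) a.1 a.2)) /separates Ev.
rewrite (bigID (fun a => (a.1 \in leaves l) && (a.2 \in leaves r))) /=.
congr (_ + _)%N; apply: eq_bigl => a.
  by rewrite andb_idl // => ->.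
have := dis a.1; case: (_ \in leaves l) => /=; last by rewrite andbT.
by move=> ->; rewrite ?andbF //= orbF andbN.
Qed.

Lemma config_weight : config G T R = weight G T.
Proof.
rewrite weightE.
have -> : \prod_(w <- addresses T) vertex_sign G T w =
    \prod_(v : vertex T) vertex_sign G T (val v).
  rewrite -(big_map val xpredT); apply: perm_big; apply: uniq_perm => [||w].
  - exact: addresses_uniq.
  - by rewrite map_inj_uniq ?index_enum_uniq //; apply: val_inj.
  apply/idP/mapP => [wP|[v _ ->]]; last exact: valP.
  by exists (SeqSub wP); rewrite ?mem_index_enum.
have signE (v : vertex T) : vertex_sign G T (val v) =
    if internal v then (if #|fiber v| == 1 then
      (-1) ^+ #|[set e in fiber v | left_to_right T (source e) (target e)]| else 0) else 1.
  rewrite /vertex_sign /internal; case E: (subtree T (val v)) => [[x|l r]|] //.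
  by have [-> ->] := fiber_node E.
rewrite (eq_bigr _ (fun v _ => signE v)) -big_mkcond /config.
(* Every nadir is internal, so [beta] is a bijection onto the internal vertices as soon as all their
   fibers are singletons. This turns the global condition into a product. *)
have sizes : beta_bij G T = [forall v, internal v ==> (#|fiber v| == 1)].
  apply/andP/forallP => [[/injectiveP inj_b /forallP im_b] v|one].
    apply/implyP => iv; move: (eqP (im_b v)); rewrite iv => /codomP[e ->].
    apply/cards1P; exists e; apply/setP => e'; rewrite !inE.
    by apply/eqP/eqP => [/inj_b|->].
  split; [apply/injectiveP => e e' ee'|apply/forallP => v; apply/eqP; apply/idP/idP].
  - have /cards1P[x Ex] := implyP (one _) (beta_internal e).
    have: e \in fiber (beta T e) by rewrite inE.
    have: e' \in fiber (beta T e) by rewrite inE ee'.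
    by rewrite Ex !inE => /eqP -> /eqP ->.
  - by case/codomP => e ->; apply: beta_internal.
  - move=> iv; have /cards1P[e Ee] := implyP (one _) iv.
    have: e \in fiber v by rewrite Ee set11.
    by rewrite inE => /eqP <-; apply: codom_f.
rewrite sizes; case: forallP => [one|/forallP]; last first.
  rewrite negb_forall => /existsP[v]; rewrite negb_imply => /andP[iv /negPf nv].
  by rewrite (bigD1 v) //= nv mul0r.
under eq_bigr => v iv do rewrite (implyP (one v) iv).
rewrite prodrXr; congr (_ ^+ _).
rewrite /nb_left_to_right -sum1dep_card (partition_big (beta T) (@internal _ _)) /=.
  by apply: eq_bigr => v _; rewrite -sum1dep_card; apply: eq_bigl => e; rewrite !inE andbC.
by move=> e _; exact: beta_internal.
Qed.
End Weight.

(** * Relations satisfied by the pairing *)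

Section Relations.
Variables (R : comPzRingType) (n : nat).
Implicit Types (m : arrows n) (P Q : seq 'I_n) (t l r : bracket 'I_n).

Local Notation weight := (weight R).
Local Notation node_sign := (node_sign R).
Local Notation cut_sign := (cut_sign R).

Lemma node_signC p q : node_sign q p = - node_sign p q.
Proof.
rewrite /node_sign addnC; case: eqP => [pq|_]; last by rewrite oppr0.
have [[-> ->]|[-> ->]] : (p = 0 /\ q = 1 \/ p = 1 /\ q = 0)%N by lia.
  by rewrite expr0 expr1.
by rewrite expr0 expr1 opprK.
Qed.

(** A Leibniz rule: the single crossing edge belongs to one of the two families, and the other
    family is empty. *)
Lemma node_signD p q p' q' : node_sign (p + p')%N (q + q')%N =
  node_sign p q * (p' + q' == 0)%N%:R + (p + q == 0)%N%:R * node_sign p' q'.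
Proof.
rewrite /node_sign addnACA.
case: p q p' q' => [|[|p]] [|[|q]] [|[|p']] [|[|q']];
  by rewrite ?addnS //= ?(mulr0, mul0r, addr0, add0r, mulr1, mul1r).
Qed.

Lemma crossing_catl m P P' Q :
  crossing m (P ++ P') Q = (crossing m P Q + crossing m P' Q)%N.
Proof. by rewrite /crossing big_cat. Qed.

Lemma crossing_catr m P Q Q' :
  crossing m P (Q ++ Q') = (crossing m P Q + crossing m P Q')%N.
Proof. by rewrite /crossing -big_split; apply: eq_bigr => i _; rewrite big_cat. Qed.

Lemma crossing_perm m P P' Q Q' : perm_eq P P' -> perm_eq Q Q' ->
  crossing m P Q = crossing m P' Q'.
Proof.
move=> PP' QQ'; rewrite /crossing (perm_big _ PP'); apply: eq_bigr => i _.
exact: perm_big.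
Qed.

Lemma cut_signC m P Q : cut_sign m Q P = - cut_sign m P Q.
Proof. exact: node_signC. Qed.

Lemma cut_sign_perm m P P' Q Q' : perm_eq P P' -> perm_eq Q Q' ->
  cut_sign m P Q = cut_sign m P' Q'.
Proof.
by move=> PP' QQ'; rewrite /cut_sign (crossing_perm m PP' QQ') (crossing_perm m QQ' PP').
Qed.

(** Each exchange reverses one cut, at the cost of a sign. The permutation is carried along because
    cuts depend on the leaves of the branches up to order. *)
Lemma weight_iso m t t' k : tree_iso t t' k ->
  perm_eq (leaves t) (leaves t') /\ weight m t' = (-1) ^+ k * weight m t.
Proof.
elim=> {t t' k} [i|a a' b b' k k' _ [pa Ea] _ [pb Eb]|a a' b b' k k' _ [pa Ea] _ [pb Eb]] /=.
- by rewrite expr0 mul1r.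
- rewrite perm_cat //; split=> //.
  by rewrite Ea Eb (cut_sign_perm m pa pb) exprD; ring.
- rewrite perm_catC perm_cat //; split=> //.
  by rewrite Ea Eb cut_signC (cut_sign_perm m pa pb) exprS exprD; ring.
Qed.

(** After the Leibniz rule, each term is a product of two cuts and of the indicator [z] that the
    third pair of subtrees is not joined. Each such product occurs twice, with opposite signs. *)
Lemma weight_jacobi m A B C : weight m (Node (Node A B) C) +
  weight m (Node (Node C A) B) + weight m (Node (Node B C) A) = 0.
Proof.
pose z P Q : R := (crossing m P Q + crossing m Q P == 0)%N%:R.
have zC P Q : z P Q = z Q P by rewrite /z addnC.
have cutD P Q S : cut_sign m (P ++ Q) S =
    cut_sign m P S * z Q S + z P S * cut_sign m Q S.
  by rewrite /cut_sign crossing_catl crossing_catr node_signD.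
rewrite /= !cutD (cut_signC m (leaves C) (leaves A)) (cut_signC m (leaves B) (leaves C)).
rewrite (cut_signC m (leaves A) (leaves B)).
rewrite (zC (leaves B) (leaves C)) (zC (leaves A) (leaves C)) (zC (leaves B) (leaves A)).
ring.
Qed.

Lemma perm_plug (c : seq (bool * bracket 'I_n)) t t' :
  perm_eq (leaves t) (leaves t') -> perm_eq (leaves (plug c t)) (leaves (plug c t')).
Proof.
by move=> tt'; elim: c => //= -[[] s] c IH /=; rewrite ?perm_cat2l ?perm_cat2r.
Qed.

(** [K] gathers the factors of the vertices outside the hole; they see the filling only through its
    leaves, up to order. *)
Lemma weight_plug m (c : seq (bool * bracket 'I_n)) t : exists K, forall t',
  perm_eq (leaves t') (leaves t) -> weight m (plug c t') = K * weight m t'.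
Proof.
elim: c => [|[b s] c [K IH]]; first by exists 1 => t' _; rewrite mul1r.
exists (K * weight m s * if b then cut_sign m (leaves s) (leaves (plug c t))
                         else cut_sign m (leaves (plug c t)) (leaves s)) => t' tt'.
have pt := perm_plug c tt'.
case: b => /=; rewrite IH //.
  by rewrite (cut_sign_perm m (perm_refl (leaves s)) pt); ring.
by rewrite (cut_sign_perm m pt (perm_refl (leaves s))); ring.
Qed.

Lemma add_arrowC m i j x y :
  add_arrow (add_arrow m i j) x y = add_arrow (add_arrow m x y) i j.
Proof. by apply/ffunP => a; rewrite !ffunE addnAC. Qed.

Lemma crossing_add m i j P Q : crossing (add_arrow m i j) P Q =
  (crossing m P Q + count_mem i P * count_mem j Q)%N.
Proof.
rewrite -[count_mem i P]sum1_count big_distrl big_mkcond -big_split; apply: eq_bigr => x _ /=.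
case: eqP => [->|xi]; rewrite ?mul1n.
  rewrite -sum1_count [X in (_ + X)%N]big_mkcond -big_split.
  by apply: eq_bigr => y _; rewrite ffunE xpair_eqE eqxx.
rewrite addn0; apply: eq_bigr => y _; rewrite ffunE xpair_eqE.
by rewrite (introF eqP xi) addn0.
Qed.

Lemma weight_add_out m i j t :
  ~~ ((i \in leaves t) && (j \in leaves t)) -> weight (add_arrow m i j) t = weight m t.
Proof.
have count0 P Q : ~~ ((i \in P) && (j \in Q)) -> (count_mem i P * count_mem j Q = 0)%N.
  by rewrite negb_and => /orP[]/count_memPn ->; rewrite ?muln0.
elim: t => //= l IHl r IHr out.
rewrite IHl ?IHr; last 2 first.
- by apply: contra out => /andP[il jl]; rewrite !mem_cat il jl !orbT.
- by apply: contra out => /andP[il jl]; rewrite !mem_cat il jl.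
rewrite /cut_sign !crossing_add !count0 ?addn0 //.
- by apply: contra out => /andP[il jl]; rewrite !mem_cat il jl ?orbT.
- by apply: contra out => /andP[il jl]; rewrite !mem_cat il jl ?orbT.
Qed.

Lemma weight_add_node m i j l r : uniq (leaves (Node l r)) ->
  weight (add_arrow m i j) (Node l r) =
    weight (add_arrow m i j) l * weight (add_arrow m i j) r * node_sign
      (crossing m (leaves l) (leaves r) + ((i \in leaves l) && (j \in leaves r)))
      (crossing m (leaves r) (leaves l) + ((i \in leaves r) && (j \in leaves l))).
Proof.
rewrite /= cat_uniq /cut_sign !crossing_add => /and3P[ul _ ur].
by rewrite !count_uniq_mem // !mulnb.
Qed.

Lemma node_leaves l r i : uniq (leaves (Node l r)) -> i \in leaves (Node l r) ->
  (i \in leaves r) = (i \notin leaves l).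
Proof.
rewrite /= cat_uniq mem_cat => /and3P[_ /hasPn dis _].
by have := dis i => /=; do 2!case: (_ \in leaves _) => //; move/(_ isT).
Qed.

Lemma node_uniq l r : uniq (leaves (Node l r)) -> uniq (leaves l) /\ uniq (leaves r).
Proof. by rewrite /= cat_uniq => /and3P[]. Qed.

Lemma node_sign_multi p q : (1 < p + q)%N -> node_sign p q = 0.
Proof. by rewrite /node_sign => /gtn_eqF ->. Qed.

(** Reversing one crossing edge changes the sign; if another edge crosses as well, both sides
    vanish. *)
Lemma node_sign_succ p q : node_sign p (q + 1)%N = - node_sign (p + 1)%N q.
Proof.
rewrite /node_sign addnA addnAC; case: eqP => [pq|_]; last by rewrite oppr0.
have -> : p = 0%N by lia.
by rewrite expr1 opprK.
Qed.

(** The extra arrow is only seen at the vertex separating [i] from [j]. The induction descends into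
    the branch containing both labels until it meets that vertex. *)
Lemma weight_flip m i j t : uniq (leaves t) -> i \in leaves t -> j \in leaves t ->
  i != j -> weight (add_arrow m j i) t = - weight (add_arrow m i j) t.
Proof.
elim: t => [x|l IHl r IHr] u it jt ij.
  by move: it jt ij; rewrite !inE => /eqP-> /eqP->; rewrite eqxx.
have [ul ur] := node_uniq u; have ir := node_leaves u it; have jr := node_leaves u jt.
rewrite !weight_add_node //.
case il: (i \in leaves l) ir => ir; case jl: (j \in leaves l) jr => jr; rewrite ir jr /= !addn0.
- by rewrite IHl // !(@weight_add_out _ _ _ r) ?ir ?jr //; ring.
- by rewrite !weight_add_out ?il ?jl ?ir ?jr // node_sign_succ; ring.
- by rewrite !weight_add_out ?il ?jl ?ir ?jr // node_sign_succ; ring.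
- by rewrite IHr // !(@weight_add_out _ _ _ l) ?il ?jl //; ring.
Qed.

Lemma crossing_ge m P Q x y : x \in P -> y \in Q -> (m (x, y) <= crossing m P Q)%N.
Proof.
move=> xP yQ; rewrite /crossing (big_rem x) //= (big_rem y) //=.
by rewrite -addnA leq_addr.
Qed.

Lemma weight_multi m i j t : uniq (leaves t) -> i \in leaves t -> j \in leaves t ->
  i != j -> (1 < m (i, j) + m (j, i))%N -> weight m t = 0.
Proof.
elim: t => [x|l IHl r IHr] u it jt ij mij.
  by move: it jt ij; rewrite !inE => /eqP-> /eqP->; rewrite eqxx.
have [ul ur] := node_uniq u; have ir := node_leaves u it; have jr := node_leaves u jt.
case il: (i \in leaves l) ir => ir; case jl: (j \in leaves l) jr => jr /=.
- by rewrite IHl ?mul0r.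
- rewrite /cut_sign node_sign_multi ?mulr0 //.
  by apply: leq_trans mij (leq_add _ _); apply: crossing_ge.
- rewrite /cut_sign node_sign_multi ?mulr0 //.
  by rewrite addnC; apply: leq_trans mij (leq_add _ _); apply: crossing_ge.
- by rewrite IHr ?mulr0 ?mul0r.
Qed.

(** The induction descends to the vertex where the three labels are first split, two against one. *)
Lemma weight_arnold m i j k t : uniq (leaves t) ->
    {subset [:: i; j; k] <= leaves t} -> uniq [:: i; j; k] ->
  weight (add_arrow (add_arrow m i j) j k) t +
  weight (add_arrow (add_arrow m j k) k i) t +
  weight (add_arrow (add_arrow m k i) i j) t = 0.
Proof.
elim: t => [x|l IHl r IHr] u sub ijk.
  have := sub i; have := sub j; rewrite !inE !eqxx !orbT => /(_ isT)/eqP jx /(_ isT)/eqP ix.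
  by move: ijk; rewrite ix jx /= inE eqxx.
have [ul ur] := node_uniq u.
(* With [z] alone on its side, the middle graph has two crossing edges and vanishes. The other two
   share the edge from [x] to [y] inside a branch, and their crossing edges run in opposite
   directions, so they cancel. *)
have mixed x y z : {subset [:: x; y; z] <= leaves (Node l r)} ->
    (x \in leaves l) = (y \in leaves l) -> (x \in leaves l) != (z \in leaves l) ->
    weight (add_arrow (add_arrow m x y) y z) (Node l r) +
    weight (add_arrow (add_arrow m y z) z x) (Node l r) +
    weight (add_arrow (add_arrow m z x) x y) (Node l r) = 0.
  move=> sub' xy xz.
  have xr := node_leaves u (sub' x (mem_head _ _)).
  have yr : (y \in leaves r) = (y \notin leaves l).
    by apply: node_leaves u (sub' y _); rewrite !inE eqxx orbT.
  have zr : (z \in leaves r) = (z \notin leaves l).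
    by apply: node_leaves u (sub' z _); rewrite !inE eqxx !orbT.
  rewrite (add_arrowC m z x) !weight_add_node // !crossing_add.
  case xl: (x \in leaves l) xy xz xr => /esym yl; case zl: (z \in leaves l) zr => // zr _ xr.
    rewrite !(@weight_add_out _ y z) ?(xl, yl, zl, xr, yr, zr) //.
    rewrite !(@weight_add_out _ z x) ?(xl, yl, zl, xr, yr, zr) //.
    rewrite !(@weight_add_out _ x y r) ?(xl, yl, zl, xr, yr, zr) //.
    rewrite !count_uniq_mem // ?(xl, yl, zl, xr, yr, zr) /= !(mul1n, muln0, mul0n, addn0).
    by rewrite (@node_sign_multi (_ + 1) (_ + 1)) ?node_sign_succ; [ring|lia].
  rewrite !(@weight_add_out _ y z) ?(xl, yl, zl, xr, yr, zr) //.
  rewrite !(@weight_add_out _ z x) ?(xl, yl, zl, xr, yr, zr) //.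
  rewrite !(@weight_add_out _ x y l) ?(xl, yl, zl, xr, yr, zr) //.
  rewrite !count_uniq_mem // ?(xl, yl, zl, xr, yr, zr) /= !(mul1n, muln0, mul0n, addn0).
  by rewrite (@node_sign_multi (_ + 1) (_ + 1)) ?node_sign_succ; [ring|lia].
(* The Arnold sum is invariant under rotation of the labels, so the isolated label may always be put
   last. *)
have rot x y z : {subset [:: x; y; z] <= leaves (Node l r)} ->
    {subset [:: y; z; x] <= leaves (Node l r)}.
  by move=> sub' w wP; apply: sub'; rewrite -(mem_rot 1).
have [ij|ij] := eqVneq (i \in leaves l) (j \in leaves l); last first.
  have [jk|jk] := eqVneq (j \in leaves l) (k \in leaves l).
    rewrite -addrA addrC mixed //; first exact: rot sub.
    by rewrite eq_sym.
  rewrite addrC addrA mixed //; first exact: rot (rot _ _ _ sub).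
    by case: (i \in _) (j \in _) (k \in _) ij jk => [] [] [].
  by case: (i \in _) (j \in _) (k \in _) ij jk => [] [] [].
have [ik|ik] := eqVneq (i \in leaves l) (k \in leaves l); last exact: mixed.
have /and3P[ir jr kr] : [&& (i \in leaves r) == (i \notin leaves l),
    (j \in leaves r) == (j \notin leaves l) & (k \in leaves r) == (k \notin leaves l)].
  by apply/and3P; split; apply/eqP; apply: node_leaves; rewrite // sub // !inE eqxx ?orbT.
rewrite !weight_add_node // !crossing_add !count_uniq_mem //.
rewrite (eqP ir) (eqP jr) (eqP kr) -ij -ik.
case ilE: (i \in leaves l) ij ik => /esym jlE /esym klE; rewrite /= !addn0.
  rewrite !(@weight_add_out _ _ _ r) ?(eqP ir, eqP jr, eqP kr, ilE, jlE, klE) //.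
  rewrite -!mulrDl IHl ?mul0r // => w; rewrite !inE.
  by case/or3P => /eqP ->; rewrite ?(ilE, jlE, klE).
rewrite !(@weight_add_out _ _ _ l) ?(eqP ir, eqP jr, eqP kr, ilE, jlE, klE) //.
rewrite -!mulrDl -!mulrDr IHr ?(mulr0, mul0r) // => w; rewrite !inE.
by case/or3P => /eqP ->; rewrite ?(eqP ir, eqP jr, eqP kr, ilE, jlE, klE).
Qed.

Lemma config_jacobi (G : graph n) c A B C (T1 T2 T3 : tree n) :
    T1 = plug c (Node (Node A B) C) :> bracket 'I_n ->
    T2 = plug c (Node (Node C A) B) :> bracket 'I_n ->
    T3 = plug c (Node (Node B C) A) :> bracket 'I_n ->
  config G T1 R + config G T2 R + config G T3 R = 0.
Proof.
move=> E1 E2 E3; rewrite !config_weight E1 E2 E3.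
have [K EK] := weight_plug G c (Node (Node A B) C).
have abc (P : bracket _) : perm_eq (leaves P) (leaves A ++ leaves B ++ leaves C) ->
    perm_eq (leaves P) (leaves (Node (Node A B) C)) by rewrite /= catA.
by rewrite !EK -?mulrDr ?weight_jacobi ?mulr0 // abc //=;
  apply/permP => p; rewrite !count_cat; lia.
Qed.

Lemma config_tree_symmetry (G : graph n) (T1 T2 : tree n) :
  tree_iso T1 T2 1 -> config G T1 R + config G T2 R = 0.
Proof.
by move/(weight_iso G) => [_ E]; rewrite !config_weight E expr1 mulN1r subrr.
Qed.

Lemma graph_loopless (G : graph n) i : G (i, i) = 0%N.
Proof. by have /andP[/forallP/(_ i)/eqP] := valP G. Qed.

Lemma config_arnold (T : tree n) m i j k (G1 G2 G3 : graph n) :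
    [/\ i != j, j != k & k != i] ->
    G1 = add_arrow (add_arrow m i j) j k :> arrows n ->
    G2 = add_arrow (add_arrow m j k) k i :> arrows n ->
    G3 = add_arrow (add_arrow m k i) i j :> arrows n ->
  config G1 T R + config G2 T R + config G3 T R = 0.
Proof.
move=> [ij jk ki] E1 E2 E3; rewrite !config_weight E1 E2 E3.
apply: weight_arnold; first exact: tree_leaves_uniq.
  by move=> x _; apply: mem_tree_leaves.
by rewrite /= !inE negb_or ij jk eq_sym ki.
Qed.

Lemma config_graph_symmetry (T : tree n) m i j (G1 G2 : graph n) :
    G1 = add_arrow m i j :> arrows n -> G2 = add_arrow m j i :> arrows n ->
  config G1 T R + config G2 T R = 0.
Proof.
move=> E1 E2; rewrite !config_weight E1 E2 weight_flip ?(subrr, addNr) //;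
  rewrite ?mem_tree_leaves ?tree_leaves_uniq //.
apply/eqP => ij; have := graph_loopless G1 i.
by rewrite E1 !ffunE -ij eqxx addn1.
Qed.

Lemma config_multi_edge (T : tree n) (G : graph n) (e e' : edge G) :
    e != e' -> [set source e; target e] = [set source e'; target e'] ->
  config G T R = 0.
Proof.
move=> ee' E; rewrite config_weight.
apply: (@weight_multi _ (source e) (target e));
  rewrite ?mem_tree_leaves ?tree_leaves_uniq ?edge_neq //.
have pos (f : edge G) : (0 < G (source f, target f))%N.
  by rewrite /source /target; case: f => -[i j] k; apply: leq_ltn_trans (ltn_ord k).
(* The two edges are either copies of the same arrow, of multiplicity at least two, or opposite
   arrows. *)
have [Et|ne] := eqVneq (tag e) (tag e').
  case: e e' ee' E Et => -[i j] [k lt_k] [b [k' lt_k']] /= ee' _ Eb.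
  rewrite /source /target /=; move: ee'; case: b / Eb lt_k' => lt_k'.
  have [le1|//] := leqP (G (i, j) + G (j, i)) 1.
  have lt1 := leq_trans (leq_addr _ _) le1.
  have kk' : k = k'.
    have := leq_trans lt_k lt1; have := leq_trans lt_k' lt1.
    by rewrite !ltnS !leqn0 => /eqP-> /eqP->.
  by move: lt_k'; rewrite -kk' => lt_k'; rewrite (bool_irrelevance lt_k lt_k') eqxx.
have := pos e'; have := pos e.
suff [-> ->] : source e' = target e /\ target e' = source e by move=> ps pt; apply: leq_add ps pt.
have : source e' \in [set source e; target e] by rewrite E !inE eqxx.
have : target e' \in [set source e; target e] by rewrite E !inE eqxx orbT.
have := edge_neq e'; have neq : (source e, target e) != (source e', target e').
  by rewrite /source /target -!surjective_pairing.
move=> st'; rewrite !inE => /orP[]/eqP Et /orP[]/eqP Es //.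
- by rewrite Et Es eqxx in st'.
- by rewrite Et Es eqxx in neq.
- by rewrite Et Es eqxx in st'.
Qed.

End Relations.

(** * Tall trees and chains *)

Section Duality.
Variables (n : nat) (o : 'I_n).
Implicit Types (u v : seq 'I_n) (m : arrows n).

(** The left-normed bracket [[..[[o, v_k], v_(k-1)], ..], v_1]. *)
Definition tall v : bracket 'I_n := plug [seq (false, Leaf a) | a <- v] (Leaf o).

(** The path [o -> v_k -> v_(k-1) -> .. -> v_1]. *)
Fixpoint chain v : arrows n :=
  if v is a :: v' then add_arrow (chain v') (head o v') a else [ffun=> 0%N].

Lemma leaves_tall v : leaves (tall v) = o :: rev v.
Proof. by elim: v => //= a v ->; rewrite rev_cons cats1. Qed.

Lemma chain_out v x y : x \notin o :: v -> chain v (x, y) = 0%N /\ chain v (y, x) = 0%N.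
Proof.
elim: v => [|a v IH] /=; first by rewrite !ffunE.
rewrite !inE => /norP[xo /norP[xa xv]].
have xh : x != head o v.
  by case: v xv {IH} => //= b v; rewrite inE => /norP[].
have [E1 E2] : chain v (x, y) = 0%N /\ chain v (y, x) = 0%N.
  by apply: IH; rewrite inE negb_or xo.
by rewrite !ffunE !xpair_eqE E1 E2 (negPf xa) (negPf xh) andbF.
Qed.

Lemma chain_interior b v a : uniq (o :: b :: v) -> a \in v ->
  exists x y, [/\ x != a, y != a,
    (0 < chain (b :: v) (x, a))%N & (0 < chain (b :: v) (a, y))%N].
Proof.
elim: v b => [//|c v IH] b uniq_v av.
have uniq_cv : uniq (o :: c :: v).
  by move: uniq_v; rewrite /= !inE !negb_or => /and3P[/and3P[_ -> ->]].
have [->|ac] := eqVneq a c.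
  exists (head o v), b; split.
  - move: uniq_cv; case: v {IH av uniq_v} => [|d v] /=; first by rewrite inE => /andP[].
    by rewrite !inE !negb_or [d == c]eq_sym => /and3P[_ /andP[]].
  - by move: uniq_v; rewrite /= !inE !negb_or => /and3P[_ /andP[]].
  - by rewrite !ffunE eqxx addn1.
  - by rewrite !ffunE eqxx addn1.
move: av; rewrite inE (negPf ac) => /(IH _ uniq_cv)[x [y [xa ya lt_x lt_y]]].
by exists x, y; split=> //; rewrite ffunE ltn_addr.
Qed.

Variable R : comPzRingType.

(** The induction peels off the label [a] hanging at the top vertex. If the path ends at [a], one
    edge crosses there, from left to right, and contributes -1; otherwise [chain_interior] provides
    two crossing edges. *)
Lemma weight_tall_chain u v : uniq (o :: u) -> perm_eq u v ->
  weight R (chain v) (tall u) = if u == v then (-1) ^+ size u else 0.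
Proof.
elim: u v => [|a u IH] [|b v] //.
- by move=> _ /perm_size.
- by move=> _ /perm_size.
move=> uniq_au uv.
have [uniq_u [ao au]] : uniq (o :: u) /\ a != o /\ a \notin u.
  move: uniq_au; rewrite /= inE negb_or.
  by case/and3P => /andP[oa ->] -> ->; rewrite eq_sym oa.
have aP : a \notin leaves (tall u).
  by rewrite leaves_tall inE mem_rev negb_or ao.
rewrite [tall _]/= -/(tall u) [weight _ _ _]/= mulr1 eqseq_cons.
have [Eab|ab] /= := eqVneq a b; rewrite -/(tall u).
  rewrite -Eab perm_cons in uv *.
  rewrite weight_add_out; last by rewrite (negPf aP) andbF.
  rewrite IH //; case: eqP => [uvE|_]; last by rewrite mul0r.
  have av : a \notin o :: v by rewrite inE negb_or ao -(perm_mem uv).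
  rewrite /cut_sign; set m := add_arrow _ _ _.
  have [-> ->] : crossing m (leaves (tall u)) [:: a] = 1%N /\
     crossing m [:: a] (leaves (tall u)) = 0%N.
    rewrite !crossing_add /= eqxx; split; last first.
      rewrite (count_memPn aP) muln0 addn0 /crossing big_seq1 big1 // => x _.
      by rewrite (chain_out x av).1.
    rewrite addn0 muln1 /crossing big1 => [|x _]; last by rewrite big_seq1 (chain_out x av).2.
    rewrite count_uniq_mem leaves_tall; last by rewrite /= mem_rev rev_uniq.
    rewrite uvE; case: (v) => [|d w]; first by rewrite inE eqxx.
    by rewrite inE mem_rev mem_head orbT.
  by rewrite /node_sign [RHS]exprS [LHS]mulrC.
have av : a \in v by have := perm_mem uv a; rewrite !inE eqxx (negPf ab).
have uniq_bv : uniq (o :: b :: v).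
  by rewrite -(perm_uniq (_ : perm_eq (o :: a :: u) (o :: b :: v))) ?perm_cons.
have [x [y [xa ya lt_x lt_y]]] := chain_interior uniq_bv av.
have leafP z : z != a -> (0 < chain (b :: v) (z, a) + chain (b :: v) (a, z))%N ->
    z \in leaves (tall u).
  move=> za lt_z; rewrite leaves_tall inE mem_rev.
  have: z \in o :: b :: v.
    by apply: contraTT lt_z => /chain_out out; rewrite (out a).1 (out a).2.
  by rewrite inE -(perm_mem uv) inE (negPf za).
rewrite /cut_sign node_sign_multi ?mulr0 //.
apply: leq_ltn_trans (_ : 1 < _)%N => //.
apply: leq_trans (leq_add lt_x lt_y) (leq_add _ _); apply: crossing_ge; rewrite ?mem_head ?leafP //.
  by rewrite ltn_addr.
by rewrite ltn_addl.
Qed.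

Lemma loopless_chain v : uniq (o :: v) -> loopless (chain v).
Proof.
move=> uv; apply/forallP => x; apply/eqP.
elim: v uv => [|a v IH] uv; first by rewrite ffunE.
have [uv' ah] : uniq (o :: v) /\ a != head o v.
  move: uv; rewrite /= inE negb_or => /and3P[/andP[oa ->] av ->]; split=> //.
  by case: (v) av => [|b w] /=; [rewrite eq_sym | rewrite inE => /norP[]].
rewrite ffunE IH // xpair_eqE; case: eqP => //= ->.
by rewrite eq_sym (negPf ah).
Qed.

Lemma joined_connect_sym m : connect_sym (joined m).
Proof. by apply: sym_connect_sym => x y; rewrite /joined orbC. Qed.

Lemma connected_weaken m m' :
  (forall x y, (0 < m (x, y))%N -> connect (joined m') x y) -> connected m -> connected m'.
Proof.
move=> sub /forallP con; apply/forallP => x; apply/forallP => y.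
have /forallP/(_ y) := con x; apply: connect_sub => {}x {}y /orP[/sub //|/sub].
by rewrite joined_connect_sym.
Qed.

Lemma connect_chain v x : x \in o :: v -> connect (joined (chain v)) (head o v) x.
Proof.
elim: v x => [|a v IH] x; first by rewrite inE => /eqP ->.
rewrite !inE orbCA => /predU1P[->|xv] /=; first exact: connect0.
apply: connect_trans (_ : connect _ (head o v) _).
  by apply: connect1; rewrite /joined !ffunE eqxx addn1 orbT.
have := IH x; rewrite inE => /(_ xv).
apply: connect_sub => y z yz; apply: connect1; move: yz.
by rewrite /joined !ffunE => /orP[]/ltn_addr-> //; rewrite orbT.
Qed.

Lemma connected_chain v : (forall x, x \in o :: v) -> connected (chain v).
Proof.
move=> full; apply/forallP => x; apply/forallP => y.
apply: connect_trans (connect_chain (full y)).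
by rewrite joined_connect_sym; apply: connect_chain.
Qed.

End Duality.

(** * Tall trees span [Lie] *)

Section LieSpan.
Variables (R : comPzRingType) (n : nat) (o : 'I_n).
Implicit Types (t : bracket 'I_n) (L : seq (bracket 'I_n)).

(** Brackets that do not use each label once get the value 0. Swaps and Jacobi moves preserve the
    leaves up to order, so their relations hold for all brackets. *)
Definition tree_class t : Lie R n :=
  if insub t is Some T then quot_class (J_rel R n) (gen R (T : tree n)) else 0.

Lemma tree_classE (T : tree n) : tree_class T = quot_class (J_rel R n) (gen R T).
Proof. by rewrite /tree_class valK. Qed.

Lemma tree_class_invalid t : ~~ perm_eq (leaves t) (enum 'I_n) -> tree_class t = 0.
Proof. by move=> invalid; rewrite /tree_class insubN. Qed.

Lemma Lie_rel x : J_rel R n x -> quot_class (J_rel R n) x = 0.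
Proof. by move=> Jx; apply/eqP; rewrite quot_class_eq0; apply/submodP/span_gen. Qed.

Lemma tree_class_swap c A B :
  tree_class (plug c (Node B A)) = - tree_class (plug c (Node A B)).
Proof.
have pAB : perm_eq (leaves (plug c (Node A B))) (leaves (plug c (Node B A))).
  by apply: perm_plug; rewrite /= perm_catC.
have [vAB|nAB] := boolP (perm_eq (leaves (plug c (Node A B))) (enum 'I_n)); last first.
  by rewrite !tree_class_invalid ?oppr0 // -(permPl pAB).
have vBA : perm_eq (leaves (plug c (Node B A))) (enum 'I_n) by rewrite -(permPl pAB).
apply/eqP; rewrite -addr_eq0 addrC; apply/eqP.
rewrite (tree_classE (Tree vAB)) (tree_classE (Tree vBA)) -raddfD /=.
apply: Lie_rel; right; exists (Tree vAB), (Tree vBA); split=> //=.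
have iso_refl t : tree_iso t t 0.
  by elim: t => [i|l IHl r IHr]; [exact: iso_leaf|have := iso_keep IHl IHr].
elim: c {pAB vAB vBA} => [|[b s] c IH] /=; first by have := iso_swap (iso_refl A) (iso_refl B).
by case: b; [have := iso_keep (iso_refl s) IH|have := iso_keep IH (iso_refl s)].
Qed.

Lemma tree_class_jacobi c A B C :
  tree_class (plug c (Node (Node A B) C)) + tree_class (plug c (Node (Node C A) B)) +
  tree_class (plug c (Node (Node B C) A)) = 0.
Proof.
set t1 := plug c _; set t2 := plug c _; set t3 := plug c _.
have [p12 p13] : perm_eq (leaves t1) (leaves t2) /\ perm_eq (leaves t1) (leaves t3).
  by split; apply: perm_plug; apply/permP => p; rewrite /= !count_cat; lia.
have [v1|n1] := boolP (perm_eq (leaves t1) (enum 'I_n)); last first.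
  by rewrite !tree_class_invalid ?addr0 -?(permPl p12) -?(permPl p13).
have v2 : perm_eq (leaves t2) (enum 'I_n) by rewrite -(permPl p12).
have v3 : perm_eq (leaves t3) (enum 'I_n) by rewrite -(permPl p13).
rewrite (tree_classE (Tree v1)) (tree_classE (Tree v2)) (tree_classE (Tree v3)) -!raddfD /=.
by apply: Lie_rel; left; exists c, A, B, C, (Tree v1), (Tree v2), (Tree v3).
Qed.

Definition tall_class (x : Lie R n) : Prop :=
  exists2 v, perm_eq (o :: v) (enum 'I_n) & x = tree_class (tall o v).

Lemma plug_cat (c c' : seq (bool * bracket 'I_n)) t : plug (c ++ c') t = plug c (plug c' t).
Proof. by elim: c => //= -[b s] c ->. Qed.

(** The bracket [[..[t, s_k], ..], s_1]: the shape of [tall], with subtrees in place of leaves. *)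
Definition hang L t := plug [seq (false, s) | s <- L] t.

Lemma hang_cat L L' t : hang (L ++ L') t = hang L (hang L' t).
Proof. by rewrite /hang map_cat plug_cat. Qed.

Fixpoint nodes t : nat := if t is Node l r then (nodes l + nodes r).+1 else 0.

Lemma nodes_split L : (exists v, L = [seq Leaf a | a <- v]) \/
  (exists L1 A B L2, L = L1 ++ Node A B :: L2).
Proof.
elim: L => [|[a|A B] L IH]; first by left; exists [::].
  case: IH => [[v ->]|[L1 [A [B [L2 ->]]]]]; first by left; exists (a :: v).
  by right; exists (Leaf a :: L1), A, B, L2.
by right; exists [::], A, B, L.
Qed.

Lemma hang_leaf_span L : tree_class (hang L (Leaf o)) \in submod tall_class.
Proof.
have [k] := ubnP (sumn [seq nodes s | s <- L]); elim: k L => // k IH L lt_k.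
have [[v Ev]|[L1 [A [B [L2 EL]]]]] := nodes_split L.
  have -> : hang L (Leaf o) = tall o v by rewrite /hang Ev -map_comp.
  have [valid|invalid] := boolP (perm_eq (o :: v) (enum 'I_n)).
    by apply/submodP/span_gen; exists v.
  rewrite tree_class_invalid ?rpred0 //; apply: contra invalid; rewrite leaves_tall.
  by rewrite -(permPl (_ : perm_eq (o :: rev v) (o :: v))) // perm_cons perm_rev.
set X := hang L2 (Leaf o).
have E s1 s2 : hang (L1 ++ s1 :: s2 :: L2) (Leaf o) =
    plug [seq (false, s) | s <- L1] (Node (Node X s2) s1).
  by rewrite hang_cat.
(* [X, [A, B]] = [[X, A], B] - [[X, B], A] decreases the number of internal
   vertices in the hanging subtrees. *)
have -> : tree_class (hang L (Leaf o)) =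
    tree_class (hang (L1 ++ B :: A :: L2) (Leaf o)) -
    tree_class (hang (L1 ++ A :: B :: L2) (Leaf o)).
  rewrite !E EL hang_cat; set c := [seq (false, s) | s <- L1].
  have swap : tree_class (plug c (Node (Node B X) A)) = - tree_class (plug c (Node (Node X B) A)).
    by have := tree_class_swap (rcons c (false, A)) X B; rewrite -cats1 !plug_cat.
  have := tree_class_jacobi c X A B; rewrite swap.
  rewrite (tree_class_swap c X (Node A B)) => /eqP; rewrite subr_eq0 => /eqP <-.
  by [].
by rewrite rpredB // IH //; move: lt_k; rewrite EL !map_cat !sumn_cat /=; lia.
Qed.

(** Descends from the root of [t] to the leaf [o], moving each branch without [o] to the end of [L],
    after a swap when it is the left one. *)
Lemma hang_span L t : o \in leaves t -> tree_class (hang L t) \in submod tall_class.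
Proof.
elim: t L => [x|l IHl r IHr] L; first by rewrite inE => /eqP <-; apply: hang_leaf_span.
rewrite mem_cat => /orP[/(IHl (rcons L r))|/(IHr (rcons L l))].
  by rewrite -cats1 hang_cat.
by rewrite -cats1 hang_cat /hang (tree_class_swap _ r l) rpredN.
Qed.

Lemma tree_class_span t : tree_class t \in submod tall_class.
Proof.
have [valid|/tree_class_invalid ->] := boolP (perm_eq (leaves t) (enum 'I_n)); last exact: rpred0.
by apply: (hang_span [::]); rewrite (perm_mem valid) mem_enum.
Qed.

End LieSpan.

(** * Chains span [Eil] *)

Section EilSpan.
Variables (R : comPzRingType) (n : nat) (o : 'I_n).
Implicit Types (m : arrows n) (v : seq 'I_n).

(** As for trees, tables with a loop or disconnected get the value 0, so that relations can be
    applied without checking validity. *)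
Definition graph_class m : Eil R n :=
  if insub m is Some G then quot_class (I_rel R n) (gen R (G : graph n)) else 0.

Lemma graph_classE (G : graph n) : graph_class G = quot_class (I_rel R n) (gen R G).
Proof. by rewrite /graph_class valK. Qed.

Lemma graph_class_invalid m : ~~ (loopless m && connected m) -> graph_class m = 0.
Proof. by move=> invalid; rewrite /graph_class insubN. Qed.

Lemma Eil_rel x : I_rel R n x -> quot_class (I_rel R n) x = 0.
Proof. by move=> Ix; apply/eqP; rewrite quot_class_eq0; apply/submodP/span_gen. Qed.

Lemma graph_class_loop m x : (0 < m (x, x))%N -> graph_class m = 0.
Proof.
move=> loop; rewrite graph_class_invalid //; apply/negP => /andP[/forallP/(_ x)/eqP Ex _].
by rewrite Ex in loop.
Qed.

Lemma loopless_add m i j : loopless (add_arrow m i j) = loopless m && (i != j).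
Proof.
apply/forallP/andP => [H|[/forallP H ij] x].
  split; last first.
    by have := H i; rewrite ffunE xpair_eqE eqxx addn_eq0 => /andP[_]; case: (i == j).
  by apply/forallP => x; have := H x; rewrite ffunE addn_eq0 => /andP[].
rewrite ffunE (eqP (H x)) xpair_eqE; have [->|//] := eqVneq x i.
by rewrite (negPf ij).
Qed.

Lemma joined_add m i j x y :
  joined (add_arrow m i j) x y = joined m x y || ((x, y) \in [:: (i, j); (j, i)]).
Proof.
rewrite /joined !ffunE !inE !addn_gt0 !lt0b orbACA; congr (_ || (_ || _)).
by rewrite !xpair_eqE andbC.
Qed.

Lemma graph_class_flip m i j :
  graph_class (add_arrow m j i) = - graph_class (add_arrow m i j).
Proof.
have E : loopless (add_arrow m i j) && connected (add_arrow m i j) =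
    loopless (add_arrow m j i) && connected (add_arrow m j i).
  rewrite !loopless_add eq_sym; congr (_ && _).
  by apply: eq_forallb => x; apply: eq_forallb => y; apply: eq_connect => {}x {}y;
    rewrite !joined_add !inE; congr (_ || _); rewrite orbC.
have [v1|n1] := boolP (loopless (add_arrow m i j) && connected (add_arrow m i j)); last first.
  by rewrite !graph_class_invalid ?oppr0 // -E.
have v2 : loopless (add_arrow m j i) && connected (add_arrow m j i) by rewrite -E.
apply/eqP; rewrite -addr_eq0 addrC; apply/eqP.
rewrite (graph_classE (Graph v1)) (graph_classE (Graph v2)) -raddfD /=.
by apply: Eil_rel; apply: Or32; exists m, i, j, (Graph v1), (Graph v2).
Qed.

Lemma graph_class_multi m i j : graph_class (add_arrow (add_arrow m i j) i j) = 0.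
Proof.
set m' := add_arrow _ _ _.
have [valid|/graph_class_invalid //] := boolP (loopless m' && connected m').
rewrite (graph_classE (Graph valid)); apply: Eil_rel; apply: Or33.
have lt1 : (1 < Graph valid (i, j))%N by rewrite /= !ffunE eqxx !addn1.
pose G := Graph valid.
exists G, (Tagged (fun a => 'I_(G a)) (Ordinal (ltnW lt1))),
  (Tagged (fun a => 'I_(G a)) (Ordinal lt1)).
by split=> //; rewrite -tag_eqE /tag_eq eqxx /= tagged_asE.
Qed.

Lemma graph_class_arnold m i j k : i != j -> j != k -> k != i ->
  graph_class (add_arrow (add_arrow m i j) j k) +
  graph_class (add_arrow (add_arrow m j k) k i) +
  graph_class (add_arrow (add_arrow m k i) i j) = 0.
Proof.
move=> ij jk ki.
(* Any two sides of a triangle connect its three vertices, so the three graphs are connected or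
   disconnected together. *)
have rot x y z : connected (add_arrow (add_arrow m x y) y z) ->
    connected (add_arrow (add_arrow m y z) z x).
  set m1 := (X in _ -> connected X); have yz : connect (joined m1) y z.
    by apply: connect1; rewrite !joined_add !inE eqxx !orbT.
  have zx : connect (joined m1) z x.
    by apply: connect1; rewrite !joined_add !inE eqxx !orbT.
  apply: connected_weaken => s t; rewrite !ffunE !addn_gt0 !lt0b => /orP[/orP[mst|]|].
  - by apply: connect1; rewrite !joined_add /joined mst.
  - case/eqP=> -> ->; rewrite joined_connect_sym; exact: connect_trans yz zx.
  - by case/eqP=> -> ->.
set m1 := add_arrow (add_arrow m i j) j k; set m2 := add_arrow (add_arrow m j k) k i.
set m3 := add_arrow (add_arrow m k i) i j.
have [[l12 l13] [c12 c13]] : (loopless m1 = loopless m2 /\ loopless m1 = loopless m3) /\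
    (connected m1 = connected m2 /\ connected m1 = connected m3).
  rewrite !loopless_add ij jk ki; split=> //; split; apply/idP/idP; do ?[exact: rot].
  - by move/rot/rot.
  - by move/rot/rot.
have [v1|n1] := boolP (loopless m1 && connected m1); last first.
  by rewrite !graph_class_invalid ?addr0 -?l12 -?l13 -?c12 -?c13.
have v2 : loopless m2 && connected m2 by rewrite -l12 -c12.
have v3 : loopless m3 && connected m3 by rewrite -l13 -c13.
rewrite (graph_classE (Graph v1)) (graph_classE (Graph v2)) (graph_classE (Graph v3)) -!raddfD /=.
by apply: Eil_rel; apply: Or31; exists m, i, j, k, (Graph v1), (Graph v2), (Graph v3).
Qed.

Definition chain_class (x : Eil R n) : Prop :=
  exists2 v, perm_eq (o :: v) (enum 'I_n) & x = graph_class (chain o v).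

(** The state of the reduction: a path already grown, and the arrows [m] still to be absorbed. *)
Definition extend m v : arrows n := [ffun a => m a + chain o v a]%N.

Lemma extend_add m i j v : extend (add_arrow m i j) v = add_arrow (extend m v) i j.
Proof. by apply/ffunP => a; rewrite !ffunE addnAC. Qed.

Lemma extend_cons m b v : extend m (b :: v) = add_arrow (extend m v) (head o v) b.
Proof. by apply/ffunP => a; rewrite !ffunE addnA. Qed.

(** Orientation is ignored, so edges can be flipped without affecting the hypotheses or the measure
    of the reduction. *)
Definition links m x y : nat := (m (x, y) + m (y, x))%N.

Lemma links_add m i j x y :
  links (add_arrow m i j) x y = (links m x y + ((x, y) == (i, j)) + ((y, x) == (i, j)))%N.
Proof. by rewrite /links !ffunE addnACA addnA. Qed.

Lemma links_flip m i j x y : links (add_arrow m j i) x y = links (add_arrow m i j) x y.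
Proof. by rewrite !links_add !xpair_eqE; lia. Qed.

Definition degree m x : nat := (\sum_y links m x y)%N.

Lemma degree_add m i j x :
  degree (add_arrow m i j) x = (degree m x + (x == i) + (x == j))%N.
Proof.
have ones (b : bool) z : (\sum_(y : 'I_n) (b && (y == z)) = b)%N.
  case: b => /=; last by rewrite big1.
  by rewrite (bigD1 z) //= eqxx big1 // => y /negPf ->.
rewrite /degree; under eq_bigr => y _ do rewrite links_add !xpair_eqE [(y == i) && _]andbC.
by rewrite !big_split /= !ones.
Qed.

Lemma degree_flip m i j x : degree (add_arrow m j i) x = degree (add_arrow m i j) x.
Proof. by apply: eq_bigr => y _; exact: links_flip. Qed.

Lemma links_split m x y : (0 < links m x y)%N ->
  exists m', m = add_arrow m' x y \/ m = add_arrow m' y x.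
Proof.
have split_arrow i j : (0 < m (i, j))%N -> exists m', m = add_arrow m' i j.
  move=> mij; exists [ffun a => m a - (a == (i, j))]%N.
  by apply/ffunP => a; rewrite !ffunE; case: eqP => [->|]; rewrite ?subnK ?subn0 ?addn0.
by rewrite addn_gt0 => /orP[]/split_arrow[m' ->]; exists m'; [left|right].
Qed.

(** If no arrow of [m] touches the path, a connected graph has no vertex off the path, and then [m]
    is empty; a disconnected one has class 0. *)
Lemma chain_span v m : uniq (o :: v) ->
    (forall x y, x \in o :: v -> links m x y = 0%N) ->
  graph_class (extend m v) \in submod chain_class.
Proof.
move=> uv free; have [/andP[_ /forallP con]|/graph_class_invalid ->] :=
  boolP (loopless (extend m v) && connected (extend m v)); last exact: rpred0.
have full x : x \in o :: v.
  have /forallP/(_ x) := con o; move/(@closed_connect _ _ (mem (o :: v))) => <-.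
    by rewrite mem_head.
  apply: intro_closed; first exact: joined_connect_sym.
  move=> y z yz yv; move: yz; rewrite /joined !ffunE.
  have := free y z yv; move/eqP; rewrite addn_eq0 => /andP[/eqP-> /eqP->].
  by apply: contraTT => zv; have [-> ->] := chain_out y zv.
have -> : extend m v = chain o v.
  apply/ffunP => -[x y]; rewrite ffunE.
  by have /eqP := free x y (full x); rewrite addn_eq0 => /andP[/eqP ->].
apply/submodP/span_gen; exists v => //.
by apply: uniq_perm; rewrite ?enum_uniq // => x; rewrite mem_enum full.
Qed.

(** [m] is free from the vertices of the path other than its end [a]. If [a]
    has a single further edge, the path grows; if it has two, to [b] and [c],
    the Arnold relation replaces one of them with an edge between [b] and [c]. *)
Lemma extend_span v m : uniq (o :: v) ->
    (forall x y, x \in o :: v -> x != head o v -> links m x y = 0%N) ->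
  graph_class (extend m v) \in submod chain_class.
Proof.
(* The outer induction is used when the path grows, the inner one, on the degree in [m] of its end,
   when an Arnold relation is applied. *)
have [N] := ubnP (n - size v); elim: N v m => // N IHN v m lt_N uv.
have [d] := ubnP (degree m (head o v)); elim: d m => // d IHd m lt_d free.
set a := head o v in lt_d free.
have flip m' i j : (graph_class (add_arrow m' j i) \in submod chain_class) =
   (graph_class (add_arrow m' i j) \in submod chain_class).
  by rewrite graph_class_flip rpredN.
have aP : a \in o :: v by rewrite /a; case: (v) => [|b w]; rewrite ?mem_head // inE mem_head orbT.
have [b mab|none] := pickP (fun b => 0 < links m a b)%N; last first.
  apply: chain_span => // x y xv; have [->|/free-> //] := eqVneq x a.
  by have := none y; case: (links m a y).
have bv : b != a -> b \notin o :: v.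
  move=> ba; apply: contraL mab => /(free b a)/(_ ba).
  by rewrite /links addnC => ->.
wlog Em : m lt_d free mab / exists m1, m = add_arrow m1 a b.
  move=> H; have [m1 [Em|Em]] := links_split mab; first by apply: H => //; exists m1.
  rewrite Em extend_add flip -extend_add; apply: H; last by exists m1.
  - by rewrite -degree_flip -Em.
  - by move=> x y xv xa; rewrite -links_flip -Em free.
  - by rewrite -links_flip -Em.
case: Em => m1 Em.
have [ba|/bv {}bv] := eqVneq b a.
  rewrite (@graph_class_loop _ a) ?rpred0 // Em extend_add ba ffunE eqxx addn1 //.
have le_links x y : (links m1 x y <= links m x y)%N.
  by rewrite Em links_add -addnA leq_addr.
have [c m1ac|none] := pickP (fun c => 0 < links m1 a c)%N; last first.
  rewrite Em extend_add -extend_cons; apply: IHN => /=.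
  - have := max_card (mem (o :: b :: v)); have /card_uniqP -> : uniq (o :: b :: v).
      by move: uv bv; rewrite /= !inE !negb_or eq_sym => /andP[-> ->] /andP[-> ->].
    by rewrite card_ord /=; lia.
  - by move: uv bv; rewrite /= !inE !negb_or eq_sym => /andP[-> ->] /andP[-> ->].
  move=> x y xP xb; have xv : x \in o :: v.
    by move: xP; rewrite !inE (negPf xb).
  have [->|xa] := eqVneq x a; first by have := none y; case: (links m1 a y).
  by have := le_links x y; rewrite free // leqn0 => /eqP.
wlog [m2 Em1] : m m1 Em lt_d free mab le_links m1ac / exists m2, m1 = add_arrow m2 a c.
  move=> H; have [m2 [Em1|Em1]] := links_split m1ac.
    by apply: (H m m1) => //; exists m2.
  rewrite Em Em1 add_arrowC extend_add flip -extend_add add_arrowC.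
  apply: (H _ (add_arrow m2 a c)) => //; last by exists m2.
  - by move: lt_d; rewrite Em Em1 !degree_add; lia.
  - move=> x y xv xa; have := free x y xv xa; rewrite Em Em1 add_arrowC links_flip.
    by rewrite add_arrowC.
  - by move: mab; rewrite Em Em1 add_arrowC links_flip add_arrowC.
  - by move=> x y; rewrite [leqRHS]links_add -addnA leq_addr.
  - by rewrite links_flip -Em1.
have cv : c != a -> c \notin o :: v.
  move=> ca; apply: contraL (leq_trans m1ac (le_links _ _)) => /(free c a)/(_ ca).
  by rewrite /links addnC => ->.
have [ca|/cv {}cv] := eqVneq c a.
  rewrite (@graph_class_loop _ a) ?rpred0 // Em Em1 !extend_add ca 2!ffunE eqxx addn1.
  by rewrite ltn_addr.
have [cb|cb] := eqVneq c b.
  by rewrite Em Em1 cb !extend_add graph_class_multi rpred0.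
rewrite Em Em1 !extend_add flip add_arrowC.
have ab : a != b by apply: contraNneq bv => <-.
have ac : a != c by apply: contraNneq cv => <-.
(* Each of the two other graphs has one arrow less at [a], so the inner measure drops. The new arrow
   joins [b] and [c], both off the path, so the path stays free. *)
have := graph_class_arnold (extend m2 v) (_ : b != a) ac cb.
rewrite eq_sym => /(_ ab) /eqP.
rewrite -addrA addr_eq0 => /eqP ->.
rewrite rpredN rpredD // -!extend_add; apply: IHd.
all: try by move: lt_d; rewrite Em Em1 !degree_add -/a !eqxx (negPf ab) (negPf ac); lia.
all: move=> x y xv xa; have := free x y xv xa; rewrite Em Em1 !links_add !xpair_eqE.
all: have [xb xc] : x != b /\ x != c by split; apply: contraTneq xv => ->.
all: by rewrite (negPf xa) (negPf xb) (negPf xc) !andbF !addn0.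
Qed.

(** The reduction starts from the path reduced to [o], for which the freeness condition is
    vacuous. *)
Lemma graph_class_span m : graph_class m \in submod chain_class.
Proof.
have <- : extend m [::] = m by apply/ffunP => a; rewrite !ffunE addn0.
by apply: extend_span => // x y; rewrite inE /= => ->.
Qed.

End EilSpan.

(** * Pairings of modules *)

Lemma freemod_sum (R : pzRingType) (K : choiceType) (g : freemod R K) :
  g = \sum_(k <- msupp g) g@_k *: gen R k.
Proof.
apply/malgP => k.
have mcoeff_sum (s : seq K) :
    (\sum_(l <- s) g@_l *: gen R l)@_k = \sum_(l <- s) (g@_l *: gen R l)@_k.
  by elim/big_ind2: _ => // [|x1 x2 y1 y2 <- <-]; rewrite ?mcoeff0 ?mcoeffD.
rewrite mcoeff_sum; under eq_bigr => l _ do rewrite freemod_scaleE mcoeffU.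
have [kg|kg] := boolP (k \in msupp g).
  rewrite (big_fsetD1 k) //= eqxx mulr1 big1_fset ?addr0 // => l.
  by rewrite !inE => /andP[/negPf-> _] _; rewrite mulr0.
rewrite big1_fset ?(mcoeff_outdom kg) // => l lg _; case: eqP => [El|_]; last by rewrite mulr0.
by rewrite El in lg; rewrite lg in kg.
Qed.

Section SpanSum.
Variables (R : pzRingType) (M : lmodType R) (I : finType) (x : I -> M) (S : M -> Prop).

Lemma submod_sum z : (forall s, S s -> exists i, s = x i) -> z \in submod S ->
  exists c : I -> R, z = \sum_i c i *: x i.
Proof.
move=> Sx /submodP; elim=> {z} [s /Sx[i ->]||a y z _ [c ->] _ [d ->]].
- exists (fun j => (j == i)%:R); rewrite (bigD1 i) //= eqxx scale1r big1 ?addr0 //.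
  by move=> j /negPf->; rewrite scale0r.
- by exists (fun=> 0); rewrite big1 // => i _; rewrite scale0r.
- exists (fun i => a * c i + d i); rewrite scaler_sumr -big_split.
  by apply: eq_bigr => i _; rewrite scalerDl scalerA.
Qed.

End SpanSum.

Section DualBases.
Variables (R : comPzRingType) (M N : lmodType R) (A : {linear M -> dual N}).
Variables (I : finType) (x : I -> M) (y : I -> N) (e : R).
Hypothesis e2 : e * e = 1.
Hypothesis Axy : forall i j, dual_fun (A (x i)) (y j) = if i == j then e else 0.
Hypothesis spanM : forall z, exists c : I -> R, z = \sum_i c i *: x i.
Hypothesis spanN : forall w, exists c : I -> R, w = \sum_i c i *: y i.

(** Evaluation at the [y j] recovers the coefficients on the [x i] up to [e], which is its own
    inverse. The inverse of [A] sends [f] to the combination with coefficients [e * f (y i)], since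
    a functional is determined on the spanning [y]. *)
Lemma dual_bases_bijective : bijective A.
Proof.
have eval c j : dual_fun (A (\sum_i c i *: x i)) (y j) = c j * e.
  have -> : dual_fun (A (\sum_i c i *: x i)) (y j) = \sum_i c i * dual_fun (A (x i)) (y j).
    rewrite linear_sum; elim/big_ind2: _ => // [|i _]; first by move=> f ? g ? <- <-.
    by rewrite linearZ.
  by rewrite (bigD1 j) //= Axy eqxx big1 ?addr0 // => i /negPf ij; rewrite Axy ij mulr0.
exists (fun f : dual N => \sum_i (e * dual_fun f (y i)) *: x i) => [z|f].
  have [c ->] := spanM z; apply: eq_bigr => i _.
  by rewrite eval mulrCA e2 mulr1.
set z := \sum_i _; have Az j : dual_fun (A z) (y j) = dual_fun f (y j).
  by rewrite eval mulrAC e2 mul1r.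
clearbody z; apply: dualP => w; have [d ->] := spanN w; rewrite !linear_sum; apply: eq_bigr => j _.
by rewrite !linearZ /= Az.
Qed.

End DualBases.

Section PairingTheory.
Variables (R : comPzRingType) (M N : lmodType R) (B : pairing M N).

Lemma pairingDl x x' y : B (x + x') y = B x y + B x' y.
Proof. exact: (raddfD (pairingr B y)). Qed.

Lemma pairingDr x y y' : B x (y + y') = B x y + B x y'.
Proof. exact: (raddfD (B x)). Qed.

End PairingTheory.

Lemma pairing_genl0 (R : comPzRingType) (K : choiceType) (N : lmodType R)
    (B : pairing (freemod R K) N) g y :
  (forall k, B (gen R k) y = 0) -> B g y = 0.
Proof.
move=> B0; rewrite [g]freemod_sum -[LHS]/(pairingr B y _) linear_sum big1 // => k _.
by rewrite linearZ /= /pairingr B0 scaler0.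
Qed.

Lemma pairing_genr0 (R : comPzRingType) (K : choiceType) (M : lmodType R)
    (B : pairing M (freemod R K)) x g :
  (forall k, B x (gen R k) = 0) -> B x g = 0.
Proof.
move=> B0; rewrite [g]freemod_sum linear_sum big1 // => k _.
by rewrite linearZ /= B0 scaler0.
Qed.

Section BilinearExtension.
Variables (R : comPzRingType) (K L : choiceType) (f : K -> L -> R).

Lemma bilin_ext_gen2l k k' l :
  bilin_ext f (gen R k + gen R k') (gen R l) = f k l + f k' l.
Proof. by rewrite pairingDl !bilin_ext_gen. Qed.

Lemma bilin_ext_gen3l k k' k'' l :
  bilin_ext f (gen R k + gen R k' + gen R k'') (gen R l) = f k l + f k' l + f k'' l.
Proof. by rewrite !pairingDl !bilin_ext_gen. Qed.

Lemma bilin_ext_gen2r k l l' :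
  bilin_ext f (gen R k) (gen R l + gen R l') = f k l + f k l'.
Proof. by rewrite pairingDr !bilin_ext_gen. Qed.

Lemma bilin_ext_gen3r k l l' l'' :
  bilin_ext f (gen R k) (gen R l + gen R l' + gen R l'') = f k l + f k l' + f k l''.
Proof. by rewrite !pairingDr !bilin_ext_gen. Qed.

End BilinearExtension.

Section QuotientPairing.
Variables (R : comPzRingType) (M N : lmodType R) (B : pairing M N).
Variables (S : M -> Prop) (S' : N -> Prop).
Hypothesis BS : forall x y, S x -> B x y = 0.
Hypothesis BS' : forall x y, S' y -> B x y = 0.

Lemma pairing_submodl x y : x \in submod S -> B x y = 0.
Proof.
move/submodP; elim=> {x} [x /BS//||a x x' _ E _ E'].
  by rewrite -[LHS]/(pairingr B y 0) linear0.
by rewrite -[LHS]/(pairingr B y _) linearP /= /pairingr E E' scaler0 addr0.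
Qed.

Lemma pairing_submodr x y : y \in submod S' -> B x y = 0.
Proof.
move/submodP; elim=> {y} [y /BS'//||a y y' _ E _ E']; first by rewrite linear0.
by rewrite linearP /= E E' scaler0 addr0.
Qed.

Lemma quot_classP (L : lmodType R) (Q : L -> Prop) (x x' : L) :
  quot_class Q x = quot_class Q x' -> x - x' \in submod Q.
Proof. by move=> E; rewrite -quot_class_eq0 raddfB /= E subrr. Qed.

Lemma pairing_quot x x' y y' : quot_class S x = quot_class S x' ->
  quot_class S' y = quot_class S' y' -> B x y = B x' y'.
Proof.
move=> /quot_classP xx' /quot_classP yy'.
rewrite -[x](subrK x') -[LHS]/(pairingr B y _) linearD /= /pairingr pairing_submodl // add0r.
by rewrite -[y](subrK y') linearD /= pairing_submodr // add0r.
Qed.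

Definition quot_repr (L : lmodType R) (Q : L -> Prop) (x : quotmod Q) : L := repr x.

Lemma quot_reprK (L : lmodType R) (Q : L -> Prop) (x : quotmod Q) :
  quot_class Q (quot_repr x) = x.
Proof. exact: reprK. Qed.

(** The pairing is computed on chosen representatives; [pairing_quot] gives both its linearity and
    its value on classes. *)
Lemma quot_pairing : exists B' : pairing (quotmod S) (quotmod S'),
  forall x y, B' (quot_class S x) (quot_class S' y) = B x y.
Proof.
pose b (x : quotmod S) (y : quotmod S') : R^o := B (quot_repr x) (quot_repr y).
have bl y : linear (b^~ y).
  move=> a x x'; rewrite /b -[RHS](pairing_linl B); apply: pairing_quot => //.
  by rewrite linearP /= !quot_reprK.
have br x : linear (b x).
  move=> a y y'; rewrite /b -[RHS](pairing_linr B); apply: pairing_quot => //.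
  by rewrite linearP /= !quot_reprK.
by exists (Pairing bl br) => x y; apply: pairing_quot; rewrite quot_reprK.
Qed.

End QuotientPairing.

(** * Perfectness of the induced configuration pairing *)

Section Perfect.
Variables (R : comPzRingType) (n : nat).

Lemma config_pairing_gen (G : graph n) (T : tree n) :
  config_pairing R n (gen R G) (gen R T) = config G T R.
Proof. exact: bilin_ext_gen. Qed.

Lemma config_pairing_I (g : Gamma R n) (t : Theta R n) :
  I_rel R n g -> config_pairing R n g t = 0.
Proof.
move=> Ig; apply: pairing_genr0 => T.
case: Ig => [[m [i [j [k [G1 [G2 [G3 [ijk E1 E2 E3 ->]]]]]]]]|[m [i [j [G1 [G2 [E1 E2 ->]]]]]]|].
- exact: etrans (bilin_ext_gen3l _ _ _ _ _) (config_arnold _ _ ijk E1 E2 E3).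
- exact: etrans (bilin_ext_gen2l _ _ _ _) (config_graph_symmetry _ _ E1 E2).
- case=> [G [e [e' [ee' E ->]]]].
  exact: etrans (bilin_ext_gen _ _ _) (config_multi_edge _ _ ee' E).
Qed.

Lemma config_pairing_J (g : Gamma R n) (t : Theta R n) :
  J_rel R n t -> config_pairing R n g t = 0.
Proof.
move=> Jt; apply: pairing_genl0 => G.
case: Jt => [[c [A [B [C [T1 [T2 [T3 [E1 E2 E3 ->]]]]]]]]|[T1 [T2 [iso ->]]]].
- exact: etrans (bilin_ext_gen3r _ _ _ _ _) (config_jacobi _ _ E1 E2 E3).
- exact: etrans (bilin_ext_gen2r _ _ _ _) (config_tree_symmetry _ _ iso).
Qed.

Lemma Eil_spanned (S : Eil R n -> Prop) (x : Eil R n) :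
  (forall m, graph_class R m \in submod S) -> x \in submod S.
Proof.
move=> spanS; rewrite -(quot_reprK x) [quot_repr x]freemod_sum linear_sum.
by apply: rpred_sum => G _; rewrite linearZ rpredZ //= -graph_classE.
Qed.

Lemma Lie_spanned (S : Lie R n -> Prop) (x : Lie R n) :
  (forall t, tree_class R t \in submod S) -> x \in submod S.
Proof.
move=> spanS; rewrite -(quot_reprK x) [quot_repr x]freemod_sum linear_sum.
by apply: rpred_sum => T _; rewrite linearZ rpredZ //= -tree_classE.
Qed.

End Perfect.

Lemma pairing_tall_chain (R : comPzRingType) (n : nat) (o : 'I_n) (u v : seq 'I_n)
    (B : pairing (Eil R n) (Lie R n)) :
    (forall g t, B (quot_class (I_rel R n) g) (quot_class (J_rel R n) t) =
       config_pairing R n g t) ->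
    perm_eq (o :: u) (enum 'I_n) -> perm_eq (o :: v) (enum 'I_n) ->
  B (graph_class R (chain o v)) (tree_class R (tall o u)) = if u == v then (-1) ^+ size u else 0.
Proof.
move=> BE pu pv.
have uniqP w : perm_eq (o :: w) (enum 'I_n) -> uniq (o :: w) by move/perm_uniq ->; apply: enum_uniq.
have validT : perm_eq (leaves (tall o u)) (enum 'I_n).
  by rewrite leaves_tall -(permPl (_ : perm_eq (o :: u) _)) // perm_cons perm_sym perm_rev.
have validG : loopless (chain o v) && connected (chain o v).
  by rewrite loopless_chain ?uniqP //= connected_chain // => x; rewrite (perm_mem pv) mem_enum.
rewrite (tree_classE R (Tree validT)) (graph_classE R (Graph validG)) BE config_pairing_gen.
rewrite config_weight weight_tall_chain ?uniqP //.
by rewrite -(perm_cons o); apply: perm_trans pu _; rewrite perm_sym.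
Qed.

Theorem theorem1p8 (R : comPzRingType) (n : nat) (n_gt0 : (1 <= n)%N) :
  (forall (g : Gamma R n) (t : Theta R n),
     g \in I_sub R n -> config_pairing R n g t = 0) /\
  (forall (g : Gamma R n) (t : Theta R n),
     t \in J_sub R n -> config_pairing R n g t = 0) /\
  exists B : pairing (Eil R n) (Lie R n),
    (forall (g : Gamma R n) (t : Theta R n),
       B (quot_class (I_rel R n) g) (quot_class (J_rel R n) t) =
       config_pairing R n g t) /\
    perfect B.
Proof.
split; first by move=> g t; apply: pairing_submodl => g' t'; apply: config_pairing_I.
split; first by move=> g t; apply: pairing_submodr => g' t'; apply: config_pairing_J.
have [B BE] := quot_pairing (@config_pairing_I R n) (@config_pairing_J R n).
exists B; split=> //.
(* Positivity of [n] provides the base label [o]; the orderings of the [k] other labels index both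
   families. *)
case: n n_gt0 B BE => // k _ B BE; pose o : 'I_k.+1 := ord0.
pose I : finType := {v : k.-tuple 'I_k.+1 | perm_eq (o :: v) (enum 'I_k.+1)}.
pose x (i : I) := graph_class R (chain o (val i)).
pose y (i : I) := tree_class R (tall o (val i)).
(* One factor -1 for each of the [k] edges of a path, all travelled from left to right in the
   matching tall tree. *)
pose e : R := (-1) ^+ k.
have e2 : e * e = 1 by rewrite /e -expr2 sqrr_sign.
have Bxy i j : B (x i) (y j) = if i == j then e else 0.
  rewrite (pairing_tall_chain BE (valP j) (valP i)) size_tuple -!val_eqE /=.
  by rewrite eq_sym.
have index v : perm_eq (o :: v) (enum 'I_k.+1) -> exists i : I, v = val i :> seq _.
  move=> pv; have sv : size v == k by have := perm_size pv; rewrite /= size_enum_ord => -[->].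
  by exists (exist _ (Tuple sv) pv).
have spanE z : exists c : I -> R, z = \sum_i c i *: x i.
  apply: submod_sum (Eil_spanned z (@graph_class_span R _ o)) => s [v /index[i Ev] ->].
  by exists i; rewrite /x -Ev.
have spanL z : exists c : I -> R, z = \sum_i c i *: y i.
  apply: submod_sum (Lie_spanned z (@tree_class_span R _ o)) => s [v /index[i Ev] ->].
  by exists i; rewrite /y -Ev.
split.
  exact: (@dual_bases_bijective _ _ _ (adjl B) _ x y e).
apply: (@dual_bases_bijective _ _ _ (adjr B) _ y x e) => // i j.
by rewrite eq_sym; apply: Bxy.
Qed.
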